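(* Let $q$ be an odd prime power, let $a,b\in\mathbb F_{q^2}$, and let $f=a\mathtt x+b\mathtt x^q+\mathtt x^{2q-1}\in\mathbb F_{q^2}[\mathtt x]$. Then $f$ is a permutation polynomial of $\mathbb F_{q^2}$ if and only if one of the following is satisfied. (i) $a=b=0$ and $q\equiv 1,3\pmod 6$. (ii) $(-a)^{\frac{q+1}{2}}=-1$ or $3$, and $b=0$. (iii) $ab\ne 0$, $a=b^{1-q}$, and $1-\frac{4a}{b^2}$ is a square of $\mathbb F_q^*$. (iv) $ab(a-b^{1-q})\ne 0$, $1-\frac{4a}{b^2}$ is a square of $\mathbb F_q^*$, and $b^2-a^2b^{q-1}-3a=0$.
   Context: $\mathbb F_q$ denotes the finite field with $q$ elements, and $\mathbb F_q\subset\mathbb F_{q^2}$ is regarded as a subfield; $\mathtt x$ is an indeterminate. A polynomial $f\in\mathbb F_{q^2}[\mathtt x]$ is called a permutation polynomial of $\mathbb F_{q^2}$ if the map $x\mapsto f(x)$ is a permutation of $\mathbb F_{q^2}$. An element $c\in\mathbb F_{q^2}$ ''is a square of $\mathbb F_q^*$'' means that $c=d^2$ for some $d\in\mathbb F_q^*=\mathbb F_q\setminus\{0\}$ (so in particular $c\in\mathbb F_q^*$). The integer $3$ in (ii) is interpreted as an element of $\mathbb F_q$. In expressions such as $b^{1-q}$ with negative exponents, $b\neq 0$ is assumed, so in (iii) and (iv) the condition $ab\neq0$ (i.e. $a\ne0$ and $b\neq 0$) is in force, and $ab(a-b^{1-q})\ne 0$ means $a\neq 0$, $b\neq 0$ and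 $a\neq b^{1-q}$. *)

(* Defs.v *)
From HB Require Import structures.
From mathcomp Require Import all_boot all_order all_algebra all_field.
Set Implicit Arguments.
Unset Strict Implicit.
Unset Printing Implicit Defensive.
Import GRing.Theory.
Local Open Scope ring_scope.

Definition permutation_polynomial (F : finFieldType) (f : {poly F}) : Prop :=
  bijective (fun x : F => f.[x]).

(* The subfield k of F is presented by its inclusion morphism iota; a square
   of k^* is the square of a nonzero element of k, so 0 is excluded. *)
Definition square_of_units (k F : finFieldType) (iota : {rmorphism k -> F})
    (c : F) : Prop :=
  exists2 d : k, d != 0 & c = iota d ^+ 2.

(* Main.v *)
Require Import Defs.
From HB Require Import structures.
From mathcomp Require Import all_boot all_order all_algebra all_field.
From mathcomp Require Import cyclic ring zify.
Set Implicit Arguments.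
Unset Strict Implicit.
Unset Printing Implicit Defensive.
Import GRing.Theory.
Local Open Scope ring_scope.

(** Write h(y) = y^2 + b y + a and let mu be the group of elements of norm one,
    that is, of (q+1)-st roots of unity.  Since f(x) = x h(x^(q-1)), the
    polynomial f permutes the field exactly when h has no root in mu and the
    rational function g(y) = y h(y)^(q-1) is injective on mu.  Writing a1 and b1
    for the conjugates a^q and b^q, one has g = N / (y h) on mu, where
    N(y) = a1 y^2 + b1 y + 1; so g has degree at most three
    ([permutation_trinomialP]).

    Sufficiency.  Two points y and z of mu collide when a symmetric polynomial of
    bidegree (2,2) in y and z vanishes.  In the last case it splits into two
      factors
    of bidegree (1,1), and conjugating either factor exchanges y and z, which
    forces y = z ([collision_factor], [circle_injective_square]).  In the third
    case N is proportional to h and g is a constant over y.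

    Necessity.  If N and h have a common root, then, h having no root in mu, they
    are proportional and this gives the third case or the first half of the second
    ([selfrec_of_res0]).  Otherwise, and if a and b are not both zero,
    let D(c) be the discriminant of the cubic N - c y h, a quartic in c.  If g
    permutes mu then for c in mu this cubic has exactly one root in mu; this
    makes D(c) / c^2 a square of the small field, and zero only when the cubic
    has a triple root ([branch_disc_circle]).  Thus the quartic D has
    constant quadratic character on mu, so that a curve of genus one would have an
    extreme number of points if D were squarefree.  Hasse's bound is not needed to
    exclude this: as in Stepanov's method, the power c^2 D^((q+1)/2) is expanded
    to second order in W = c^(q+1) - 1, and the first-order differential equation
    it satisfies yields, up to a factor c^2, a polynomial of degree at most four
    that W divides and that is therefore zero ([constant_character_quartic]).  This identity makes every nonzero root of D
    multiple, so that every branch point of g is totally ramified.  A function of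
    degree three has two such points, or a single one in characteristic three;
    comparing the coefficients of the Hessian of the cubic then gives b = 0 and
    a a1 = 9, or the closing equation of the last case ([total_branching]). 
      Now D is a
    constant times a square, and the sign of its quadratic character yields the
    remaining condition ([nine_sign], [total_branching_square]).  The degree
      count requires
    q > 3; for q = 3 the four values of D on mu are computed directly
    ([branch_locus_three]). *)

(** * Finite fields *)

Lemma finField_prim_root (F : finFieldType) :
  exists g : F, (#|F|.-1).-primitive_root g.
Proof.
have F1 := finNzRing_gt1 F.
pose rs := enum (predC1 (0 : F)).
have rs_root : all (#|F|.-1).-unity_root rs.
  apply/allP => x; rewrite mem_enum => x0; apply/unity_rootP.
  apply: (mulfI x0); rewrite -exprS mulr1 prednK ?expf_card //; exact: ltnW.
have rs_size : (#|F|.-1 <= size rs)%N by rewrite -cardE cardC1.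
have F1' : (0 < #|F|.-1)%N by rewrite -subn1 subn_gt0.
by have /hasP[g _ ?] := has_prim_root F1' rs_root (enum_uniq _) rs_size; exists g.
Qed.

(** Euler's criterion. *)
Lemma finField_sqrt (F : finFieldType) (x : F) :
  odd #|F| -> x ^+ (#|F|.-1 %/ 2) = 1 -> exists y, x = y ^+ 2.
Proof.
move=> oddF xm.
have F1 := finNzRing_gt1 F.
have [Feq m0] : (#|F|.-1 = 2 * (#|F|.-1 %/ 2))%N /\ (0 < #|F|.-1 %/ 2)%N.
  by move: F1 oddF; move: #|_| => N; lia.
have [g gP] := finField_prim_root F.
have x1 : x ^+ #|F|.-1 = 1 by rewrite Feq mulnC exprM xm expr1n.
have [i xE] := prim_rootP gP x1; move: xm; rewrite xE -exprM.
move/eqP; rewrite -(prim_order_dvd gP) {1}Feq => dv.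
have : (2 %| i)%N.
  by rewrite -(dvdn_pmul2r m0).
case/dvdnP => j ->; exists (g ^+ j); by rewrite -exprM.
Qed.

(** A power of the Frobenius automorphism, as a ring morphism. *)
Lemma frobenius_morph (p n : nat) (F : finFieldType) : p \in [pchar F] ->
  exists cj : {rmorphism F -> F}, forall x, cj x = x ^+ (p ^ n).
Proof.
move=> pF; elim: n => [|n [cj cjE]].
  by exists idfun => x; rewrite expn0 expr1.
exists (pFrobenius_aut pF \o cj) => x.
by rewrite /= pFrobenius_autE cjE -exprM expnSr.
Qed.

(** * The involution of a quadratic extension and its unit circle *)

Section Involution.

Variables (F : finFieldType) (q : nat) (cj : {rmorphism F -> F}).
Hypotheses (cardF : #|F| = (q ^ 2)%N) (q_odd : odd q) (q_gt1 : (1 < q)%N).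
Hypothesis cjE : forall x, cj x = x ^+ q.

(** The unit circle, that is, the elements of norm one: the kernel of the norm
    from the field with q^2 elements to the field with q elements. *)
Definition unitary (c : F) := c * cj c == 1.

Lemma cjK : involutive cj.
Proof. by move=> x; rewrite !cjE -exprM mulnn -cardF expf_card. Qed.

Lemma unitary_neq0 c : unitary c -> c != 0.
Proof. by apply: contraTneq => ->; rewrite /unitary mul0r eq_sym oner_neq0. Qed.

Lemma unitary_cj c : unitary c -> cj c = c^-1.
Proof.
move=> uc; apply: (mulfI (unitary_neq0 uc)).
by rewrite divff ?unitary_neq0 //; apply/eqP.
Qed.

Lemma unitaryE c : unitary c = (c ^+ q.+1 == 1).
Proof. by rewrite /unitary cjE -exprS. Qed.

Lemma unitaryM c d : unitary c -> unitary d -> unitary (c * d).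
Proof.
rewrite /unitary rmorphM => /eqP c1 /eqP d1.
by rewrite mulrACA c1 d1 mulr1.
Qed.

Lemma unitaryV c : unitary c -> unitary c^-1.
Proof. by rewrite /unitary fmorphV -invfM => /eqP ->; rewrite invr1. Qed.

Lemma unitary1 : unitary 1.
Proof. by rewrite /unitary rmorph1 mulr1. Qed.

Lemma card_pred_eq : (#|F|.-1 = q.-1 * q.+1)%N.
Proof. by rewrite cardF; case: q q_gt1 => // k _; rewrite -mulnn; lia. Qed.

Lemma unitary_prim_root : exists z : F, q.+1.-primitive_root z.
Proof.
have [g] := finField_prim_root F; rewrite card_pred_eq => gP.
exists (g ^+ q.-1); have := exp_prim_root gP q.-1.
have q1 : (0 < q.-1)%N by lia.
by rewrite gcdnMr mulKn.
Qed.

Lemma exp_unitary (x : F) : x != 0 -> unitary (x ^+ q.-1).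
Proof.
move=> x0; rewrite unitaryE -exprM -card_pred_eq; apply/eqP.
by apply: (mulfI x0); rewrite mulr1 -exprS prednK ?expf_card // cardF expn_gt0;
  lia.
Qed.

(** Hilbert's Theorem 90 for the quadratic extension. *)
Lemma hilbert90 (y : F) : unitary y -> exists2 x, x != 0 & x ^+ q.-1 = y.
Proof.
rewrite unitaryE => /eqP y1.
have [g] := finField_prim_root F; rewrite card_pred_eq => gP.
have y2 : y ^+ (q.-1 * q.+1) = 1 by rewrite mulnC exprM y1 expr1n.
have [i yE] := prim_rootP gP y2.
move: y1; rewrite yE -exprM => /eqP; rewrite -(prim_order_dvd gP).
rewrite dvdn_pmul2r // => /dvdnP[j ->]; exists (g ^+ j).
  by apply: expf_neq0; rewrite (prim_root_eq0 gP); lia.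
by rewrite -exprM.
Qed.

Lemma sqrt_half (x : F) : x ^+ (q.-1 * (q.+1 %/ 2)) = 1 -> exists y, x = y ^+ 2.
Proof.
move=> x1; apply: finField_sqrt.
  by rewrite cardF oddX q_odd orbT.
by rewrite card_pred_eq; rewrite muln_divA // dvdn2 /= q_odd in x1.
Qed.

(** An element that conjugation multiplies by the square of a point of the unit
    circle is a square; with w = 1, this covers the elements of the subfield. *)
Lemma sqrt_cj (x w : F) : unitary w -> cj x = x * w ^+ 2 -> exists y, x = y ^+ 2.
Proof.
move=> uw; rewrite cjE; have [-> _|x0 xw] := eqVneq x 0.
  by exists 0; rewrite expr0n.
apply: sqrt_half; rewrite exprM.
have -> : x ^+ q.-1 = w ^+ 2.
  by apply: (mulfI x0); rewrite -exprS prednK // ltnW.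
by rewrite -exprM mulnC divnK ?dvdn2 /= ?q_odd //; apply/eqP; rewrite -unitaryE.
Qed.

Lemma unitary_poly_dvd (P : {poly F}) :
  (forall c, unitary c -> root P c) -> 'X^(q.+1) - 1 %| P.
Proof.
move=> rP; have [z zP] := unitary_prim_root.
rewrite -(factor_Xn_sub_1 zP) -(big_map (fun i => z ^+ i) xpredT (fun x => 'X -
  x%:P)).
apply: uniq_roots_dvdp.
  apply/allP => _ /mapP[i _ ->]; apply: rP.
  by rewrite unitaryE exprAC (prim_expr_order zP) expr1n.
rewrite uniq_rootsE map_inj_in_uniq ?iota_uniq // => i j.
rewrite !mem_index_iota => /= iq jq /eqP.
by rewrite (eq_prim_root_expr zP) !modn_small // => /eqP.
Qed.

End Involution.

(** * Reduction to a rational function on the unit circle *)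

(** The quadratic polynomial h such that f(x) = x h(x^(q-1)). *)
Definition hquad (R : comPzRingType) (a b y : R) := y ^+ 2 + b * y + a.

(** The reciprocal of h when a1 and b1 stand for the conjugates of a and b;
    on the unit circle, y h(y)^(q-1) = hrec y / (y h(y)). *)
Definition hrec (R : comPzRingType) (a1 b1 y : R) := a1 * y ^+ 2 + b1 * y + 1.

(** The degree three rational function y h(y)^(q-1), written as a fraction with
    numerator hrec and denominator y h(y), takes distinct values at distinct
    points of the unit circle. *)
Definition circle_injective (F : finFieldType) (cj : {rmorphism F -> F})
    (a b : F) :=
  forall y z, unitary cj y -> unitary cj z ->
    hrec (cj a) (cj b) y * (z * hquad a b z) =
    hrec (cj a) (cj b) z * (y * hquad a b y) -> y = z.

Section Reduction.

Variables (F : finFieldType) (q : nat) (cj : {rmorphism F -> F}).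
Hypotheses (cardF : #|F| = (q ^ 2)%N) (q_odd : odd q) (q_gt1 : (1 < q)%N).
Hypothesis cjE : forall x, cj x = x ^+ q.
Variables a b : F.

Local Notation h := (hquad a b).
Local Notation N := (hrec (cj a) (cj b)).
Local Notation f := (a *: 'X + b *: 'X^q + 'X^(2 * q - 1)).

Lemma trinomialE (x : F) : f.[x] = x * h (x ^+ q.-1).
Proof.
rewrite !hornerE /hquad.
have {1}-> : q = q.-1.+1 by lia.
have -> : (2 * q - 1)%N = (q.-1 * 2).+1 by lia.
by rewrite !exprS exprM; ring.
Qed.

Lemma hrec_unitary y : unitary cj y -> N y = y ^+ 2 * cj (h y).
Proof.
move=> uy; have y0 := unitary_neq0 uy.
rewrite /hrec /hquad !(rmorphD, rmorphXn, rmorphM) /= (unitary_cj uy).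
by field.
Qed.

(* The value h(y)^(q-1), on the unit circle. *)
Let hpow y : unitary cj y -> h y != 0 ->
  y * h y ^+ q.-1 = N y / (y * h y).
Proof.
move=> uy h0; have y0 := unitary_neq0 uy.
rewrite hrec_unitary // cjE.
have -> : h y ^+ q = h y * h y ^+ q.-1 by rewrite -exprS prednK // ltnW.
by field; rewrite y0 h0.
Qed.

Let eq_ratio y z : unitary cj y -> unitary cj z -> h y != 0 -> h z != 0 ->
  y * h y ^+ q.-1 = z * h z ^+ q.-1 <->
  N y * (z * h z) = N z * (y * h y).
Proof.
move=> uy uz hy hz; have y0 := unitary_neq0 uy; have z0 := unitary_neq0 uz.
rewrite !hpow //; split => [/eqP|/eqP E].
  by rewrite eqr_div ?mulf_neq0 // => /eqP.
by apply/eqP; rewrite eqr_div ?mulf_neq0.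
Qed.

Lemma permutation_trinomialP :
  permutation_polynomial f <->
  (forall y, unitary cj y -> h y != 0) /\ circle_injective cj a b.
Proof.
rewrite /permutation_polynomial; split => [/bij_inj injf | [h0 inj]]; last first.
  apply: injF_bij => x z; rewrite !trinomialE.
  have f0 t : t != 0 -> t * h (t ^+ q.-1) != 0.
    by move=> t0; rewrite mulf_neq0 // h0 // (exp_unitary cardF).
  have [->|x0] := eqVneq x 0; have [->|z0] := eqVneq z 0 => // E.
  - by have := f0 _ z0; rewrite -E mul0r eqxx.
  - by have := f0 _ x0; rewrite E mul0r eqxx.
  have ux : unitary cj (x ^+ q.-1) by apply: (exp_unitary cardF).
  have uz : unitary cj (z ^+ q.-1) by apply: (exp_unitary cardF).
  have xz : x ^+ q.-1 = z ^+ q.-1.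
    apply: inj => //; apply/eq_ratio; rewrite ?h0 //.
    by rewrite -!exprMn E.
  by move: E; rewrite xz; apply: mulIf; apply: h0.
have h0 y : unitary cj y -> h y != 0.
  move=> /(hilbert90 cardF q_odd q_gt1 cjE)[x x0 <-]; apply: contra_neq x0 => hx0.
  by apply: injf; rewrite !trinomialE hx0 mulr0 mul0r.
split=> // y z uy uz /eq_ratio; rewrite !h0 // => /(_ uy uz isT isT).
have [x x0 xy] := hilbert90 cardF q_odd q_gt1 cjE uy.
have [t t0 tz] := hilbert90 cardF q_odd q_gt1 cjE uz.
rewrite -{1}xy -{1}tz -!exprMn => E.
have w0 : t * h z != 0 by rewrite mulf_neq0 // h0.
pose r := x * h y / (t * h z).
have r1 : r ^+ q.-1 = 1 by rewrite expr_div_n E divff // expf_neq0.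
have rt : (r * t) ^+ q.-1 = z by rewrite exprMn r1 mul1r.
rewrite -xy -rt; congr (_ ^+ _); apply: injf; rewrite !trinomialE rt xy /r.
have hz := h0 _ uz.
by field; rewrite t0 hz.
Qed.

End Reduction.

(** * Sufficiency *)

Lemma four_neq0 (K : fieldType) : 2%:R != 0 :> K -> 4%:R != 0 :> K.
Proof. by move=> two0; rewrite (natrM _ 2 2) mulf_neq0. Qed.

(** The collision polynomial, symmetric in y and z: the quotient by z - y of the
    numerator of the difference of the values of hrec y / (y h(y)) at y and z. *)
Definition collision (R : comPzRingType) (a b a1 b1 y z : R) :=
  (y + z) ^+ 2 + (b + b1 * (y * z)) * (y + z) + a1 * (y * z) ^+ 2
  + (b * b1 - a * a1 - 1) * (y * z) + a.

Lemma collisionE (R : comPzRingType) (a b a1 b1 y z : R) :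
  hrec a1 b1 y * (z * hquad a b z) - hrec a1 b1 z * (y * hquad a b y)
  = (z - y) * collision a b a1 b1 y z.
Proof. by rewrite /hrec /hquad /collision; ring. Qed.

(** With d a square root of 1 - 4a/b^2, the collision polynomial is the product
    of a polynomial of bidegree (1,1) in y and z and of its transpose. *)
Lemma collision_factor (K : fieldType) (a b a1 b1 d y z : K) :
  4%:R != 0 :> K -> b1 != 0 -> 1 - d != 0 -> 1 + d != 0 ->
  4%:R * a = b ^+ 2 * (1 - d ^+ 2) -> 4%:R * a1 = b1 ^+ 2 * (1 - d ^+ 2) ->
  b * b1 * (1 - d ^+ 2) ^+ 2 = 4%:R * (1 + 3%:R * d ^+ 2) ->
  let u := - 2%:R / (b1 * (1 + d)) in
  let v := - 2%:R / (b1 * (1 - d)) in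
  collision a b a1 b1 y z =
    a1 * (y * z - u * y - v * z + b / b1) * (y * z - v * y - u * z + b / b1).
Proof.
move=> four0 b10 d1 d2 aE a1E nE u v.
have dd : 1 - d ^+ 2 != 0.
  by have -> : 1 - d ^+ 2 = (1 - d) * (1 + d) by [ring]; rewrite mulf_neq0.
have -> : a = b ^+ 2 * (1 - d ^+ 2) / 4%:R by rewrite -aE mulrC mulKf.
have -> : a1 = b1 ^+ 2 * (1 - d ^+ 2) / 4%:R by rewrite -a1E mulrC mulKf.
have -> : b = 4%:R * (1 + 3%:R * d ^+ 2) / (b1 * (1 - d ^+ 2) ^+ 2).
  by rewrite -nE; field; rewrite b10 dd.
by rewrite /collision /u /v; field; rewrite b10 d1 d2 dd four0.
Qed.

Section Sufficiency.

Variables (F : finFieldType) (q : nat) (cj : {rmorphism F -> F}).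
Hypotheses (cardF : #|F| = (q ^ 2)%N) (q_odd : odd q) (q_gt1 : (1 < q)%N).
Hypothesis cjE : forall x, cj x = x ^+ q.
Hypothesis two0 : 2%:R != 0 :> F.
Variables a b : F.

Local Notation h := (hquad a b).
Local Notation a1 := (cj a).
Local Notation b1 := (cj b).
Local Notation cjK := (cjK cardF cjE).
Let four0 : 4%:R != 0 :> F := four_neq0 two0.

Lemma circle_injectiveP :
  (forall y z, unitary cj y -> unitary cj z ->
     collision a b a1 b1 y z = 0 -> y = z) <->
  circle_injective cj a b.
Proof.
split=> inj y z uy uz E; last first.
  by apply: inj => //; apply/eqP; rewrite -subr_eq0 collisionE E mulr0.
move/eqP: E; rewrite -subr_eq0 collisionE mulf_eq0 subr_eq0.
by case/orP => [/eqP->|/eqP/inj->].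
Qed.

(** A root of h on the unit circle is a root of its reciprocal, hence collides
    with every point. *)
Lemma hquad_neq0_of_injective y :
  (forall y z, unitary cj y -> unitary cj z ->
     collision a b a1 b1 y z = 0 -> y = z) ->
  unitary cj y -> h y != 0.
Proof.
move=> inj uy; apply/eqP => hy.
have Ny : hrec a1 b1 y = 0.
  by rewrite (hrec_unitary a b uy) hy rmorph0 mulr0.
have uNy : unitary cj (- y) by rewrite /unitary rmorphN mulrNN.
have y0 := unitary_neq0 uy.
have yNy : y != - y by rewrite -subr_eq0 opprK -mulr2n -mulr_natl mulf_neq0.
case/eqP: (yNy); apply: inj => //.
have /eqP := collisionE a b a1 b1 y (- y).
rewrite Ny hy !(mul0r, mulr0) subrr eq_sym mulf_eq0 subr_eq0 eq_sym.
by rewrite (negPf yNy) => /eqP.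
Qed.

(** When h is proportional to its reciprocal, the rational function is a
    multiple of 1/y. *)
Lemma circle_injective_selfrec : a * a1 = 1 -> b1 = a1 * b ->
  (forall y, unitary cj y -> h y != 0) -> circle_injective cj a b.
Proof.
move=> aa1 b1E h0 y z uy uz.
have NE t : hrec a1 b1 t = a1 * h t.
  by rewrite /hrec /hquad b1E -aa1; ring.
have a10 : a1 != 0 by apply: contra_eq_neq aa1 => ->;
  rewrite mulr0 eq_sym oner_neq0.
rewrite !NE => E.
have : (a1 * h y * h z) * z = (a1 * h y * h z) * y by rewrite -[LHS]mulrA [h z
  * z]mulrC E; ring.
by move/mulfI => ->; rewrite ?mulf_neq0 ?h0.
Qed.

(** The roots of h are b (e - 1) / 2 with e = d or e = - d; as e is fixed by
    conjugation, the norm of such a root is one only if e = 0 or e = 1. *)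
Lemma hquad_neq0_selfrec (d : F) : b != 0 -> a = b / b1 -> d != 0 -> cj d = d ->
  1 - 4%:R * a / b ^+ 2 = d ^+ 2 -> forall y, unitary cj y -> h y != 0.
Proof.
move=> b0 aE d0 dR dE y uy; apply/eqP => hy.
have b10 : b1 != 0 by rewrite fmorph_eq0.
have E1 : (2%:R * y + b) ^+ 2 = (b * d) ^+ 2.
  rewrite exprMn -dE.
  have -> : (2%:R * y + b) ^+ 2 = b ^+ 2 - 4%:R * a + 4%:R * h y by rewrite
    /hquad; ring.
  by rewrite hy; field.
have d2E : b * b1 * (1 - d ^+ 2) = 4%:R by rewrite -dE aE; field; rewrite b0 b10.
have [e [eR ed] yE] : exists2 e, cj e = e /\ e ^+ 2 = d ^+ 2 & 2%:R * y = b *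
  (e - 1).
  move/eqP: E1; rewrite eqf_sqr => /orP[] /eqP E1.
    by exists d => //; rewrite mulrBr -E1; ring.
  by exists (- d); rewrite ?rmorphN ?dR ?sqrrN //; rewrite mulrBr mulrN -E1; ring.
have : 4%:R * (y * cj y) = b * b1 * (e - 1) ^+ 2.
  transitivity ((2%:R * y) * cj (2%:R * y)).
    by rewrite rmorphM rmorph_nat; ring.
  by rewrite yE rmorphM rmorphB rmorph1 eR; ring.
rewrite (eqP uy) mulr1 -d2E -ed => /(mulfI (mulf_neq0 b0 b10)) /eqP.
rewrite -subr_eq0.
have -> : 1 - e ^+ 2 - (e - 1) ^+ 2 = - (2%:R * e * (e - 1)) by ring.
have e0 : e != 0 by rewrite -sqrf_eq0 ed sqrf_eq0.
rewrite oppr_eq0 !mulf_eq0 (negPf two0) (negPf e0) subr_eq0 /= => /eqP e1.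
by have := four0; rewrite -d2E -ed e1 expr1n subrr mulr0 eqxx.
Qed.

(** When b = 0 and a has norm 9, distinct colliding points y and z satisfy
    (3 y z - a)^2 = - a (y - z)^2; the quotient e of 3 y z - a by y - z would then
    have norm 3 by the hypothesis on a, and norm -3 by conjugation. *)
Lemma circle_injective_nine : b = 0 -> (- a) ^+ (q.+1 %/ 2) = 3%:R ->
  3%:R != 0 :> F -> forall y z, unitary cj y -> unitary cj z ->
  collision a b a1 b1 y z = 0 -> y = z.
Proof.
move=> b0 am three0 y z uy uz; rewrite /collision b0 rmorph0.
have q2 : (2 * (q.+1 %/ 2) = q.+1)%N by lia.
have a0 : a != 0.
  apply: contra_eq_neq am => ->; rewrite oppr0 expr0n.
  have -> : (q.+1 %/ 2 == 0)%N = false by lia.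
  by rewrite eq_sym.
have aa : a * a1 = 9%:R.
  have -> : a * a1 = (- a) ^+ q.+1.
    by rewrite cjE -exprS exprNn -signr_odd /= q_odd expr0 mul1r.
  by rewrite -q2 mulnC exprM am -natrX.
have a1E : a1 = 9%:R / a by rewrite -aa mulrAC divff // mul1r.
have y0 := unitary_neq0 uy; have z0 := unitary_neq0 uz.
move=> E; apply/eqP; rewrite -subr_eq0; apply/negPn/negP => yz0.
have E1 : a * (y - z) ^+ 2 = - (3%:R * (y * z) - a) ^+ 2.
  transitivity (a * ((y - z) ^+ 2 - 0)); first by rewrite subr0.
  by rewrite -E a1E; field.
pose e := (3%:R * (y * z) - a) / (y - z).
have e2 : e ^+ 2 = - a by rewrite expr_div_n -[X in X / _]opprK -E1; field.
have e1 : cj e = 3%:R / a * e.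
  have cyz : cj (y - z) != 0 by rewrite fmorph_eq0.
  move: cyz; rewrite fmorph_div !(rmorphB, rmorphM, rmorph_nat) /= a1E.
  rewrite !(unitary_cj uy, unitary_cj uz) /e => cyz.
  have zy0 : z - y != 0 by rewrite -opprB oppr_eq0.
  by field; rewrite yz0 y0 z0 a0 mulN1r zy0.
have : e * cj e = 3%:R by rewrite cjE -exprS -q2 exprM e2.
rewrite e1 mulrCA -expr2 e2 mulrN divfK // => /eqP.
rewrite -subr_eq0.
have -> : - 3%:R - 3%:R = - (2%:R * 3%:R) :> F by ring.
by rewrite oppr_eq0 mulf_eq0 (negPf two0) (negPf three0).
Qed.


Lemma circle_injective_square (d : F) : a != 0 -> b != 0 -> d != 0 -> cj d = d ->
  1 - 4%:R * a / b ^+ 2 = d ^+ 2 -> b ^+ 3 - a ^+ 2 * b1 - 3%:R * a * b = 0 ->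
  forall y z, unitary cj y -> unitary cj z ->
  collision a b a1 b1 y z = 0 -> y = z.
Proof.
move=> a0 b0 d0 dR dE bE.
have b10 : b1 != 0 by rewrite fmorph_eq0.
have aE : 4%:R * a = b ^+ 2 * (1 - d ^+ 2) by rewrite -dE; field.
have a1E : 4%:R * a1 = b1 ^+ 2 * (1 - d ^+ 2).
  by have := congr1 cj aE; rewrite !(rmorphM, rmorphB, rmorph1, rmorph_nat) /= dR.
have dd : (1 - d) * (1 + d) != 0.
  apply: contra_neq a0 => dd; apply: (mulfI four0); rewrite aE mulr0.
  by have -> : 1 - d ^+ 2 = (1 - d) * (1 + d) by [ring]; rewrite dd mulr0.
have := dd; rewrite mulf_eq0 negb_or => /andP[d1 d2].
have nE : b * b1 * (1 - d ^+ 2) ^+ 2 = 4%:R * (1 + 3%:R * d ^+ 2).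
  apply: (mulfI (expf_neq0 3 b0)); apply/eqP; rewrite -subr_eq0; apply/eqP.
  transitivity ((b ^+ 2 * (1 - d ^+ 2)) ^+ 2 * b1
     - b ^+ 3 * 16%:R + 12%:R * b * (b ^+ 2 * (1 - d ^+ 2))); first by ring.
  transitivity (- 16%:R * (b ^+ 3 - a ^+ 2 * b1 - 3%:R * a * b)).
    by rewrite -aE; ring.
  by rewrite bE mulr0.
have [u uE] : {u | u = - 2%:R / (b1 * (1 + d))} by eexists.
have [v vE] : {v | v = - 2%:R / (b1 * (1 - d))} by eexists.
have [w wE] : {w | w = b / b1} by eexists.
have uv : u - v != 0.
  have -> : u - v = 4%:R * d / (b1 * ((1 - d) * (1 + d))).
    by rewrite uE vE; field; rewrite b10 d1 d2.
  by rewrite !mulf_neq0 ?four0 // invr_eq0 mulf_neq0.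
have cuw : w * cj u = u.
  rewrite uE wE fmorph_div !(rmorphM, rmorphD, rmorphN, rmorph1, rmorph_nat) /=
    cjK dR.
  by field; rewrite b10 b0 d2.
have cvw : w * cj v = v.
  rewrite vE wE fmorph_div !(rmorphM, rmorphD, rmorphN, rmorph1, rmorph_nat) /=
    cjK dR.
  by field; rewrite b10 b0 d1.
have cw : w * cj w = 1.
  by rewrite wE fmorph_div /= cjK; field; rewrite b0 b10.
(* Conjugating a bidegree (1,1) factor exchanges y and z in it. *)
have factor0 y z : unitary cj y -> unitary cj z ->
    y * z - u * y - v * z + w = 0 -> y = z.
  move=> uy uz E; have := congr1 cj E.
  rewrite !(rmorphD, rmorphM, rmorphN, rmorph0) /= => E1.
  have : (u - v) * (y - z) = 0.
    transitivity (w * ((y * cj y) * (z * cj z) - cj u * (y * cj y) * z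
       - cj v * (z * cj z) * y + y * z * cj w) - (y * z - u * y - v * z + w)).
      rewrite (eqP uy) (eqP uz).
      transitivity (w - (w * cj u) * z - (w * cj v) * y + (w * cj w) * (y * z)
        - (y * z - u * y - v * z + w)); last by ring.
      by rewrite cuw cvw cw; ring.
    rewrite E subr0.
    transitivity (w * (y * z * (cj y * cj z - cj u * cj y - cj v * cj z + cj w))).
      by ring.
    by rewrite E1 !mulr0.
  by move/eqP; rewrite mulf_eq0 (negPf uv) subr_eq0 => /eqP.
move=> y z uy uz.
rewrite (collision_factor _ _ four0 b10 d1 d2 aE a1E nE) -uE -vE -wE => /eqP.
have a10 : a1 != 0 by rewrite fmorph_eq0.
rewrite !mulf_eq0 (negPf a10) /= => /orP[]/eqP E; first exact: factor0.
by apply/esym/factor0 => //; rewrite -[RHS]E; ring.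
Qed.

End Sufficiency.

(** * The branch discriminant *)

(** The discriminant in y of the cubic pencil
    hrec a1 b1 y - c y (hquad a b y) = - c y^3 + (a1 - b c) y^2 + (b1 - a c) y
      + 1,
    a quartic in the parameter c. *)
Definition branch_disc (R : comPzRingType) (a b a1 b1 c : R) :=
  (a1 - b * c) ^+ 2 * (b1 - a * c) ^+ 2 + 4%:R * c * (b1 - a * c) ^+ 3
  - 4%:R * (a1 - b * c) ^+ 3 - 27%:R * c ^+ 2
  - 18%:R * c * (a1 - b * c) * (b1 - a * c).

(** Its derivative with respect to c. *)
Definition branch_disc' (R : comPzRingType) (a b a1 b1 c : R) :=
  - 2%:R * b * (a1 - b * c) * (b1 - a * c) ^+ 2
  - 2%:R * a * (a1 - b * c) ^+ 2 * (b1 - a * c) + 4%:R * (b1 - a * c) ^+ 3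
  - 12%:R * a * c * (b1 - a * c) ^+ 2 + 12%:R * b * (a1 - b * c) ^+ 2
  - 54%:R * c - 18%:R * (a1 - b * c) * (b1 - a * c)
  + 18%:R * c * (b * (b1 - a * c) + a * (a1 - b * c)).

(** Its second derivative. *)
Definition branch_disc'' (R : comPzRingType) (a b a1 b1 c : R) :=
  2%:R * b ^+ 2 * (b1 - a * c) ^+ 2
  + 8%:R * a * b * (a1 - b * c) * (b1 - a * c)
  + 2%:R * a ^+ 2 * (a1 - b * c) ^+ 2 - 24%:R * a * (b1 - a * c) ^+ 2
  + 24%:R * a ^+ 2 * c * (b1 - a * c) - 24%:R * b ^+ 2 * (a1 - b * c) - 54%:R
  + 36%:R * (b * (b1 - a * c) + a * (a1 - b * c)) - 36%:R * a * b * c.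

Section DoubleRoot.

Variables (K : fieldType) (a b a1 b1 c r s : K).
Hypotheses (beta : a1 - b * c = c * (2%:R * r + s))
  (gamma : b1 - a * c = - c * (r ^+ 2 + 2%:R * r * s))
  (delta : 1 = c * (r ^+ 2 * s)).

Let rs0 : r ^+ 2 * s != 0.
Proof. by apply: contra_eq_neq delta => ->; rewrite mulr0 oner_neq0. Qed.

Let r0 : r != 0.
Proof. by apply: contraNneq rs0 => ->; rewrite expr0n mul0r. Qed.

Let s0 : s != 0.
Proof. by apply: contraNneq rs0 => ->; rewrite mulr0. Qed.

Let cE : c = (r ^+ 2 * s)^-1.
Proof. by apply: (mulIf rs0); rewrite -delta mulVf. Qed.

(** If the member of the pencil at c is -c (y - r)^2 (y - s), then c is a simple
    root of the discriminant, in characteristic other than two, unless r = s or r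
    is a root of h, hence also of its reciprocal. *)
Lemma branch_disc'_double :
  branch_disc' a b a1 b1 c = - 4%:R * c ^+ 3 * (r - s) ^+ 3 * (r * hquad a b r).
Proof.
rewrite /branch_disc' /hquad beta gamma cE.
by field; rewrite r0 s0.
Qed.

(** At a triple root that is not a root of h, the discriminant vanishes to order
    exactly two outside characteristics two and three. *)
Lemma branch_disc''_triple : r = s ->
  branch_disc'' a b a1 b1 c = - 54%:R * c ^+ 2 * (r * hquad a b r) ^+ 2.
Proof.
move=> rs; rewrite /branch_disc'' /hquad beta gamma cE -rs.
by field.
Qed.

End DoubleRoot.

(** The cubic at the parameter c is - c (y - r)^3. *)
Definition triple_root (K : fieldType) (a b a1 b1 c r : K) :=
  [/\ a1 - b * c = 3%:R * c * r, b1 - a * c = - (3%:R * c * r ^+ 2)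
    & 1 = c * r ^+ 3].

Section BranchCircle.

Variables (F : finFieldType) (q : nat) (cj : {rmorphism F -> F}).
Hypotheses (cardF : #|F| = (q ^ 2)%N) (q_odd : odd q) (q_gt1 : (1 < q)%N).
Hypothesis cjE : forall x, cj x = x ^+ q.
Hypothesis two0 : 2%:R != 0 :> F.
Variables a b : F.

Local Notation h := (hquad a b).
Local Notation a1 := (cj a).
Local Notation b1 := (cj b).
Local Notation N := (hrec a1 b1).
Local Notation cjK := (cjK cardF cjE).

Hypothesis h0 : forall y, unitary cj y -> h y != 0.
Hypothesis inj : circle_injective cj a b.

Let four0 : 4%:R != 0 :> F := four_neq0 two0.

Lemma circle_surjective c : unitary cj c ->
  exists2 r, unitary cj r & N r = c * (r * h r).
Proof.
move=> uc; pose U := [set y | unitary cj y].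
pose g y := N y / (y * h y).
have den0 y : unitary cj y -> y * h y != 0.
  by move=> uy; rewrite mulf_neq0 ?h0 // (unitary_neq0 uy).
have gU : g @: U \subset U.
  apply/subsetP => x /imsetP[y]; rewrite !inE => uy ->; rewrite /g.
  rewrite hrec_unitary // /unitary !(fmorph_div, rmorphM, rmorphXn) /= cjK
    (unitary_cj uy).
  have hy := h0 uy; have chy : cj (h y) != 0 by rewrite fmorph_eq0.
  by apply/eqP; field; rewrite (unitary_neq0 uy) hy chy.
have ginj : {in U &, injective g}.
  move=> y z; rewrite !inE => uy uz /eqP; rewrite eqr_div ?den0 // => /eqP E.
  exact: inj.
have /eqP gUE : g @: U == U by rewrite eqEcard gU (card_in_imset ginj) /=.
have : c \in g @: U by rewrite gUE inE.
case/imsetP => r; rewrite inE => ur cE; exists r => //.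
by rewrite cE divfK ?den0.
Qed.

(** For c on the unit circle the cubic has exactly one root r there.  The
    discriminant is (w v)^2, where v is the value at r of the quadratic cofactor
    and w^2 is the discriminant of that cofactor.  Conjugation multiplies w by
    r / c or by - r / c; in the second case both roots of the cofactor lie on the
    circle, hence are equal to r. *)
Lemma branch_disc_circle c : unitary cj c ->
  c ^+ 2 * branch_disc a b a1 b1 c ^+ (q.+1 %/ 2) = branch_disc a b a1 b1 c /\
  (branch_disc a b a1 b1 c = 0 -> exists r, triple_root a b a1 b1 c r).
Proof.
move=> uc; have [r ur rE] := circle_surjective uc.
have c0 := unitary_neq0 uc; have r0 := unitary_neq0 ur.
have mE : (q.+1 = 2 * (q.+1 %/ 2))%N by lia.
(* The cubic is (y - r) (- c y^2 + e y - 1 / r). *)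
have [e eD] : {e | e = a1 - b * c - c * r} by eexists.
have betaE : a1 - b * c = e + c * r by rewrite eD subrK.
have gammaE : b1 - a * c = - (r^-1) - e * r.
  apply: (mulfI r0); apply/eqP; rewrite -subr_eq0; apply/eqP.
  transitivity (N r - c * (r * h r)); last by rewrite rE subrr.
  by rewrite eD /hrec /hquad; field.
have uniq_root y : unitary cj y -> - c * y ^+ 2 + e * y - r^-1 = 0 -> y = r.
  move=> uy yE; apply: inj => //.
  have -> : N y = c * (y * h y).
    apply/eqP; rewrite -subr_eq0; apply/eqP.
    transitivity ((y - r) * (- c * y ^+ 2 + e * y - r^-1)).
      transitivity (- c * y ^+ 3 + (a1 - b * c) * y ^+ 2 + (b1 - a * c) * y + 1).
        by rewrite /hrec /hquad; ring.
      by rewrite betaE gammaE; field.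
    by rewrite yE mulr0.
  by rewrite rE; ring.
have ce : cj e = e * r / c.
  have := congr1 cj betaE; rewrite !(rmorphD, rmorphN, rmorphM) /= cjK.
  rewrite (unitary_cj uc) (unitary_cj ur) => E.
  have -> : cj e = a - b1 / c - c^-1 * r^-1 by rewrite E addrK.
  have -> : a - b1 / c = - (b1 - a * c) / c by field.
  by rewrite gammaE; field; rewrite r0 c0.
pose v := - c * r ^+ 2 + e * r - r^-1.
have cv : cj v = v / (c * r).
  rewrite /v !(rmorphD, rmorphD, rmorphN, rmorphM, rmorphXn, fmorphV) /= ce.
  rewrite (unitary_cj uc) (unitary_cj ur) invrK.
  by field; rewrite r0 c0.
have [w wE] : exists w, e ^+ 2 - 4%:R * c / r = w ^+ 2.
  apply: (sqrt_cj cardF q_odd q_gt1 cjE (w := r / c)).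
    by rewrite unitaryM ?unitaryV.
  rewrite !(rmorphD, rmorphN, rmorphM, rmorphXn, fmorphV, rmorph_nat) /= ce.
  rewrite (unitary_cj uc) (unitary_cj ur) invrK.
  by field; rewrite r0 c0.
have discE : branch_disc a b a1 b1 c = (w * v) ^+ 2.
  rewrite exprMn -wE /branch_disc betaE gammaE /v.
  by field.
have tripleP : c * r ^+ 3 = 1 -> e = 2%:R * c * r -> triple_root a b a1 b1 c r.
  move=> cr3 eE; have rV : r^-1 = c * r ^+ 2.
    by apply: (mulfI r0); rewrite divff // -cr3; ring.
  by split=> //; rewrite ?betaE ?gammaE ?rV eE; ring.
have cw : cj w = w * r / c \/ cj w = - (w * r / c).
  have : cj w ^+ 2 == (w * r / c) ^+ 2; last first.
    by rewrite eqf_sqr => /orP[] /eqP; [left | right].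
  rewrite -rmorphXn /= -wE.
  rewrite !(rmorphD, rmorphN, rmorphM, rmorphXn, fmorphV, rmorph_nat) /= ce.
  rewrite (unitary_cj uc) (unitary_cj ur) invrK.
  have -> : (w * r / c) ^+ 2 = (e ^+ 2 - 4%:R * c / r) * r ^+ 2 / c ^+ 2.
    by rewrite wE; field.
  by apply/eqP; field; rewrite r0 c0.
have wminus : cj w = - (w * r / c) -> w = 0 /\ triple_root a b a1 b1 c r.
  move=> cwE.
  have root t : t ^+ 2 = w ^+ 2 -> cj t = - (t * r / c) -> e + t = 2%:R * c * r.
    move=> t2 ct; have <- : (e + t) / (2%:R * c) = r.
      apply: uniq_root.
        rewrite /unitary fmorph_div rmorphM rmorphD rmorph_nat /= ce ct.
        have -> : (e + t) / (2%:R * c) * ((e * r / c - t * r / c) / (2%:R * cj c))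
          = r * (e ^+ 2 - t ^+ 2) / (4%:R * c * (c * cj c)).
          have cc0 : cj c != 0 by rewrite fmorph_eq0.
          by field; rewrite c0 cc0 two0 four0.
        rewrite (eqP uc) t2 -wE; apply/eqP; field.
        by rewrite c0 r0 four0.
      transitivity ((t ^+ 2 - (e ^+ 2 - 4%:R * c / r)) * - (4%:R * c)^-1).
        by field; rewrite c0 r0 four0 two0.
      by rewrite wE t2 subrr mul0r.
    by field; rewrite c0 two0.
  have E1 := root w erefl cwE.
  have E2 : e - w = 2%:R * c * r.
    by apply: root; rewrite ?sqrrN // rmorphN cwE; ring.
  have w0 : w = 0.
    apply: (mulfI two0); rewrite mulr0 -(subrr (2%:R * c * r)) -{1}E1 -E2; ring.
  have eE : e = 2%:R * c * r by rewrite -E1 w0 addr0.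
  split=> //; apply: tripleP => //.
  move: wE; rewrite w0 expr0n /= eE => /eqP; rewrite subr_eq0 => /eqP E.
  have c40 : 4%:R * c != 0 by rewrite mulf_neq0 ?four0.
  apply: (mulfI c40); rewrite mulr1; transitivity ((2%:R * c * r) ^+ 2 * r).
    by ring.
  by rewrite E; field.
split.
  case: cw => [cw|/wminus[w0 _]]; last first.
    by rewrite discE w0 mul0r expr0n /= expr0n;
      have -> : (q.+1 %/ 2 == 0)%N = false by [lia]; rewrite mulr0.
  rewrite discE -exprM -mE [_ ^+ q.+1]exprS -cjE rmorphM /= cw cv.
  by field; rewrite c0 r0.
rewrite discE => /eqP; rewrite sqrf_eq0 mulf_eq0 => wv.
exists r; case/orP: wv => [/eqP w0|/eqP v0].
  by case: wminus => //; rewrite w0 rmorph0 !mul0r oppr0.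
have rE2 : (c * r ^+ 2)^-1 = r.
  apply: uniq_root.
    by rewrite unitaryV // unitaryM // expr2 unitaryM.
  transitivity (v / (c * r ^+ 3)); last by rewrite v0 mul0r.
  by rewrite /v; field; rewrite c0 r0.
have cr3 : c * r ^+ 3 = 1.
  by rewrite exprSr mulrA -{2}rE2 divff // mulf_neq0 // expf_neq0.
apply: tripleP => //.
apply: (mulfI r0); apply/eqP; rewrite -subr_eq0; apply/eqP; rewrite -v0 /v.
have -> : r^-1 = c * r ^+ 2.
  by apply: (mulfI r0); rewrite divff // -cr3; ring.
by ring.
Qed.

End BranchCircle.

(** * Quartics of constant quadratic character on the unit circle *)

Lemma size_le5 (R : nzSemiRingType) (P : {poly R}) : (size P <= 5)%N ->
  P = Poly [:: P`_0; P`_1; P`_2; P`_3; P`_4].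
Proof.
move=> sP; apply/polyP => -[|[|[|[|[|i]]]]]; rewrite coef_Poly //=.
by rewrite nth_nil nth_default // (leq_trans sP).
Qed.

(** For a quartic D with first and second Euler derivatives T and TT, where the
    Euler derivative is X times the derivative, and a quadratic V with its two
    lowest coefficients tied to those of D, the coefficients of degrees 0, 1, 7
    and 8 cancel. *)
Lemma quartic_expansion (R : comNzRingType) (d0 d1 d2 d3 d4 v : R) :
  let D := Poly [:: d0; d1; d2; d3; d4] in
  let T := Poly [:: 0; d1; 2%:R * d2; 3%:R * d3; 4%:R * d4] in
  let TT := Poly [:: 0; d1; 4%:R * d2; 9%:R * d3; 16%:R * d4] in
  let V := Poly [:: 2%:R * d0; d1; v; 0; 0] in
  let w := 2%:R * v - 2%:R * d2 in
  T ^+ 2 + 2%:R * D * (3%:R * T - TT - 4%:R * D + 2%:R * V) =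
  'X^2 * Poly [:: d1 ^+ 2 + 2%:R * d0 * w;
    4%:R * d1 * d2 + 2%:R * (- 4%:R * d0 * d3 + d1 * w);
    6%:R * d1 * d3 + 4%:R * d2 ^+ 2
      + 2%:R * (- 8%:R * d0 * d4 - 4%:R * d1 * d3 + d2 * w);
    8%:R * d1 * d4 + 12%:R * d2 * d3
      + 2%:R * (- 8%:R * d1 * d4 - 4%:R * d2 * d3 + d3 * w);
    d3 ^+ 2 + 2%:R * d4 * w].
Proof.
by rewrite /= !cons_poly_def; ring.
Qed.

(* The expansion of z in powers of W, when W = X^(q+1) - 1 and z = X^2 D^m with
   2 m = q + 1; doubling avoids the denominators. *)
Section Expansion.

Variables (K : fieldType) (D V W z : {poly K}).
Hypothesis zE : 2%:R * z =
  2%:R * D + (4%:R * D - 'X * D^`()) * W + V * W ^+ 2.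

Lemma expansion_low_coef : W.[0] = -1 -> W^`().[0] = 0 ->
  z.[0] = 0 -> z^`().[0] = 0 -> V`_0 = 2%:R * D`_0 /\ V`_1 = D`_1.
Proof.
move=> W0 W1 z0 z1.
have deriv_coef0 (P : {poly K}) : P`_1 = P^`().[0] by rewrite horner_coef0
  coef_deriv.
have natC k : k%:R = k%:R%:P :> {poly K} by rewrite polyC_natr.
have := congr1 (horner^~ 0) zE; have := congr1 (fun P => P^`().[0]) zE.
rewrite !deriv_coef0 -!horner_coef0 /= !natC.
rewrite expr2 !(derivD, derivN, derivM, derivC, derivX).
rewrite !(hornerD, hornerN, hornerM, hornerC, hornerX) W0 W1 z0 z1 => E1 E0.
split; apply/eqP; rewrite -subr_eq0; apply/eqP.
  transitivity (2%:R * D.[0] + (4%:R * D.[0] - 0 * D^`().[0]) * -1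
    + V.[0] * (-1 * -1)); first by ring.
  by rewrite -E0 mulr0.
transitivity (0 * D.[0] + 2%:R * D^`().[0] + ((0 * D.[0] + 4%:R * D^`().[0]
    - (1 * D^`().[0] + 0 * D^`()^`().[0])) * -1 + (4%:R * D.[0] - 0 *
      D^`().[0]) * 0)
    + (V^`().[0] * (-1 * -1) + V.[0] * (0 * -1 + -1 * 0))); first by ring.
by rewrite -E1 !mulr0 addr0.
Qed.

Lemma expansion_deriv : 'X * W^`() = W + 1 ->
  2%:R * D * ('X * z^`()) = ('X * D^`() + 4%:R * D) * z ->
  W != 0 ->
  ('X * D^`()) ^+ 2 + 2%:R * D * (3%:R * ('X * D^`())
     - 'X * ('X * D^`())^`() - 4%:R * D + 2%:R * V)
  = - W * (2%:R * D * ('X * V^`() + 2%:R * V) - ('X * D^`() + 4%:R * D) * V).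
Proof.
move=> dW dz W0; apply: (mulIf W0); apply/eqP; rewrite -subr_eq0; apply/eqP.
have := congr1 (fun P => 'X * P^`()) zE.
rewrite -!polyC_natr !(derivD, derivN, derivM, derivC, derivX, deriv_exp)
  !polyC_natr => E.
transitivity (2%:R * D * ('X * (0 * z + 2%:R * z^`())) - ('X * D^`() + 4%:R *
  D) * (2%:R * z)).
  have -> : 'X * (0 * z + 2%:R * z^`()) = 2%:R * ('X * D^`())
      + (4%:R * ('X * D^`()) - 'X * (D^`() + 'X * D^`()^`())) * W
      + (4%:R * D - 'X * D^`()) * (W + 1) + ('X * V^`()) * W ^+ 2
      + 2%:R * V * W * (W + 1).
    by rewrite E -dW; ring.
  by rewrite zE; ring.
transitivity (2%:R * (2%:R * D * ('X * z^`()) - ('X * D^`() + 4%:R * D) * z)).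
  by ring.
by rewrite dz subrr mulr0.
Qed.

End Expansion.

Section ConstantCharacter.

Variables (F : finFieldType) (q : nat) (cj : {rmorphism F -> F}).
Hypotheses (cardF : #|F| = (q ^ 2)%N) (q_odd : odd q) (q_gt1 : (1 < q)%N).
Hypothesis cjE : forall x, cj x = x ^+ q.
Hypothesis qF : q%:R = 0 :> F.
Hypothesis q_gt4 : (4 < q)%N.

Variable D : {poly F}.
Hypothesis sizeD : (size D <= 5)%N.
Hypothesis charD : forall c, unitary cj c ->
  c ^+ 2 * D.[c] ^+ (q.+1 %/ 2) = D.[c].
Hypothesis doubleD : forall c, unitary cj c -> D.[c] = 0 -> D^`().[c] = 0.

Let m := (q.+1 %/ 2)%N.
Let W : {poly F} := 'X^(q.+1) - 1.
Let th (P : {poly F}) := 'X * P^`().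
Let z := 'X^2 * D ^+ m.

Let mE : (2 * m = q.+1)%N. Proof. by rewrite /m; lia. Qed.

Let derivW : W^`() = 'X^q.
Proof.
by rewrite /W derivB derivXn -polyC1 derivC subr0 /= -mulr_natl mulrS
  -polyC_natr qF addr0 mul1r.
Qed.

Let thW : th W = W + 1.
Proof. by rewrite /th derivW -exprS subrK. Qed.

Let m2E : m%:R * 2%:R = 1 :> {poly F}.
Proof. by rewrite -natrM mulnC mE mulrS -polyC_natr qF addr0. Qed.

Let m1E : m = m.-1.+1. Proof. by lia. Qed.

(* The differential equation satisfied by X^2 D^m. *)
Let thz : 2%:R * D * th z = (th D + 4%:R * D) * z.
Proof.
rewrite /th /z derivM derivXn deriv_exp.
have -> : D ^+ m = D * D ^+ m.-1 by rewrite {1}m1E exprS.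
rewrite -[D^`() * _ *+ m]mulr_natl.
transitivity ((m%:R * 2%:R) * ('X * D^`()) * 'X^2 * (D * D ^+ m.-1)
  + 4%:R * D * ('X^2 * (D * D ^+ m.-1))); first by rewrite /=; ring.
by rewrite m2E mul1r; ring.
Qed.

Let dvdW (P : {poly F}) : (forall c, unitary cj c -> root P c) -> W %| P.
Proof. exact: unitary_poly_dvd. Qed.

Let rootW c : unitary cj c -> W.[c] = 0.
Proof. by rewrite (unitaryE cjE) => /eqP c1; rewrite !hornerE c1 subrr. Qed.

(* The expansion of 2 X^2 D^m in powers of W, to the second order. *)
Let expansion : exists V : {poly F},
  2%:R * z = 2%:R * D + (4%:R * D - th D) * W + V * W ^+ 2.
Proof.
have /dvdpP[R RE] : W %| z - D.
  apply: dvdW => c uc; rewrite /root !hornerE subr_eq0.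
  by apply/eqP; rewrite charD.
have zE : z = D + R * W by rewrite -RE subrKC.
have thzE : th z = th D + th R * W + R * (W + 1).
  by rewrite -thW /th zE !derivE; ring.
suff /dvdpP[V VE] : W %| 2%:R * R - 4%:R * D + th D.
  exists V; rewrite zE; transitivity (2%:R * D + (4%:R * D - th D) * W
    + (2%:R * R - 4%:R * D + th D) * W); first by ring.
  by rewrite VE; ring.
apply: dvdW => c uc.
have [D0|D0] := eqVneq D.[c] 0.
  have D10 := doubleD uc D0.
  have R0 : R.[c] = 0.
    have : z^`().[c] = 0.
      have Dm0 : (D ^+ m).[c] = 0 by rewrite horner_exp D0 m1E exprS mul0r.
      rewrite /z derivM [(D ^+ m)^`()]deriv_exp hornerD !hornerM Dm0.
      by rewrite hornerMn hornerM D10 mul0r mul0rn !mulr0 addr0.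
    rewrite zE derivD derivM derivW !hornerD !hornerM D10 (rootW uc) mulr0
      !add0r hornerXn.
    by move/eqP; rewrite mulf_eq0 expf_eq0 (negPf (unitary_neq0 uc)) andbF orbF
      => /eqP.
  by rewrite /root /th !hornerE D0 D10 R0 !(mulr0, subr0, addr0).
rewrite /root; apply/eqP/(mulfI D0); rewrite mulr0 -hornerM.
have -> : D * (2%:R * R - 4%:R * D + th D)
   = W * ((th D + 2%:R * D) * R - 2%:R * D * th R).
  have := thz; rewrite thzE zE => E.
  apply/eqP; rewrite -subr_eq0; apply/eqP.
  transitivity (2%:R * D * (th D + th R * W + R * (W + 1))
     - (th D + 4%:R * D) * (D + R * W)); first by ring.
  by rewrite E subrr.
by rewrite hornerM rootW // mul0r.
Qed.

Let coef_th (P : {poly F}) i : (th P)`_i = i%:R * P`_i.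
Proof. by rewrite /th coefXM; case: i => [|i] /=;
  rewrite ?mul0r // coef_deriv mulr_natl. Qed.

Let size_th (P : {poly F}) n : (size P <= n)%N -> (size (th P) <= n)%N.
Proof.
by move=> sP; apply/leq_sizeP => i ni;
  rewrite coef_th nth_default ?mulr0 // (leq_trans sP).
Qed.

Let size_sum (P Q : {poly F}) n :
  (size P <= n)%N -> (size Q <= n)%N -> (size (P + Q)%R <= n)%N.
Proof. by move=> sP sQ; rewrite (leq_trans (size_polyD _ _)) // geq_max sP. Qed.

Let size_natl (P : {poly F}) k n : (size P <= n)%N -> (size (k%:R * P)%R <= n)%N.
Proof.
by move=> sP; rewrite mulr_natl -scaler_nat (leq_trans (size_scale_leq _ _)).
Qed.

(** Hypothesis charD says that D(c) / c^2 is zero or a nonzero square of the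
    subfield for all c on the unit circle, and doubleD that D has no simple root
    there.  Then every root of D other than 0 is multiple, in any extension, and
    if D vanishes at 0 or has degree less than four then its coefficient of
    degree 1 or 3, respectively, vanishes too. *)
Lemma constant_character_quartic :
  D %| ('X * D^`()) ^+ 2 /\ exists w, D`_1 ^+ 2 = w * D`_0 /\ D`_3 ^+ 2 = w *
    D`_4.
Proof.
have [V VE] := expansion.
have sizeW : size W = q.+2 by rewrite size_XnsubC.
have sizez : (size z <= 2 * q + 5)%N.
  have sDm : (size (D ^+ m)%R <= (4 * m).+1)%N.
    apply: leq_trans (size_poly_exp_leq _ _) _.
    by rewrite ltnS leq_mul2r; move: sizeD; move: (size D) => s; lia.
  apply: leq_trans (size_polyMleq _ _) _; rewrite size_polyXn.
  by move: sDm mE; move: (size _) => s; lia.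
have sizeT : (size (4%:R * D - th D)%R <= 5)%N.
  by rewrite size_sum ?size_natl // size_polyN size_th.
have sizeV : (size V <= 3)%N.
  have [->|V0] := eqVneq V 0; first by rewrite size_poly0.
  have W0 : W != 0 by rewrite -size_poly_eq0 sizeW.
  have W20 : W ^+ 2 != 0 by rewrite expf_neq0.
  have : (size (V * W ^+ 2)%R <= 2 * q + 5)%N.
    have -> : V * W ^+ 2 = 2%:R * z + - (2%:R * D + (4%:R * D - th D) * W).
      by rewrite VE; ring.
    rewrite size_sum ?size_natl // size_polyN size_sum ?size_natl //.
      by rewrite (leq_trans sizeD) // leq_addl.
    rewrite (leq_trans (size_polyMleq _ _)) // sizeW.
    by move: sizeT; move: (size _) => s; lia.
  rewrite size_mul // expr2 size_mul // sizeW.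
  by move: (size V) => s; lia.
have W0 : W != 0 by rewrite -size_poly_eq0 sizeW.
have [V0 V1] : V`_0 = 2%:R * D`_0 /\ V`_1 = D`_1.
  apply: (expansion_low_coef VE).
  - by rewrite /W !hornerE expr0n /= sub0r.
  - by rewrite derivW hornerXn expr0n; have -> : (q == 0)%N = false by lia.
  - by rewrite /z hornerM hornerXn expr0n mul0r.
  - by rewrite /z derivM derivXn hornerD !hornerM hornerMn !hornerXn !expr0n
    /=; ring.
have := expansion_deriv VE thW thz W0.
set E := (X in X = _) => EW.
have [w [e3 [e4 [e5 EE']]]] : exists w e3 e4 e5, E = 'X^2 *
    Poly [:: D`_1 ^+ 2 + 2%:R * D`_0 * w; e3; e4; e5;
      D`_3 ^+ 2 + 2%:R * D`_4 * w].
  have DE := size_le5 sizeD.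
  have thDE : th D = Poly [:: 0; D`_1; 2%:R * D`_2; 3%:R * D`_3; 4%:R * D`_4].
    by rewrite [LHS](size_le5 (size_th sizeD)) !coef_th mul0r mul1r.
  have ththDE : th (th D) = Poly [:: 0; D`_1; 4%:R * D`_2; 9%:R * D`_3;
    16%:R * D`_4].
    rewrite [LHS](size_le5 (size_th (size_th sizeD))) !coef_th !mulrA -!natrM.
    by rewrite !mul0r !mul1r.
  have VE5 : V = Poly [:: 2%:R * D`_0; D`_1; V`_2; 0; 0].
    rewrite [LHS](size_le5 (leq_trans sizeV (isT : 3 <= 5)%N)) V0 V1.
    by rewrite [V`_3]nth_default // [V`_4]nth_default // (leq_trans sizeV).
  have := quartic_expansion D`_0 D`_1 D`_2 D`_3 D`_4 V`_2.
  cbv zeta; rewrite -DE -thDE -ththDE -VE5.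
  by move=> EE; do 4 eexists; exact: EE.
move: EE'; set E' := Poly _ => EE'.
(* E' has degree at most 4 and is a multiple of W, of degree q + 1. *)
have E'0 : E' = 0.
  apply/eqP/negPn/negP => E'0.
  have : W %| E'.
    apply: dvdW => c uc; rewrite /root.
    have c0 : c ^+ 2 != 0 by rewrite expf_neq0 ?(unitary_neq0 uc).
    rewrite -(inj_eq (mulfI c0)) mulr0 -hornerXn -hornerM -EE' EW.
    by rewrite hornerM hornerN rootW // oppr0 mul0r.
  move/(dvdp_leq E'0); rewrite sizeW leqNgt => /negP[].
  by rewrite ltnS; apply: leq_trans (size_Poly _) _ => /=; lia.
split.
  apply/dvdpP; exists (- (2%:R * (3%:R * th D - th (th D) - 4%:R * D + 2%:R *
    V))).
  apply/eqP; rewrite -subr_eq0; apply/eqP; transitivity E;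
    first by rewrite /E /th; ring.
  by rewrite EE' E'0 mulr0.
exists (- 2%:R * w).
have E'i i : E'`_i = 0 by rewrite E'0 coef0.
split; apply/eqP; rewrite -subr_eq0; apply/eqP.
  by rewrite -[RHS](E'i 0%N) coef_Poly /=; ring.
by rewrite -[RHS](E'i 4) coef_Poly /=; ring.
Qed.

End ConstantCharacter.

(** * Pencils all of whose branch points are total *)

(** The resultant of h and its reciprocal, where h counts as a quadratic and its
    reciprocal as a form of degree two: it vanishes exactly when the rational
    function has degree less than three. *)
Definition base_res (R : comPzRingType) (a b a1 b1 : R) :=
  (1 - a * a1) ^+ 2 - (b - a * b1) * (b1 - a1 * b).

Lemma base_res0 (K : fieldType) (a b a1 b1 r : K) :
  hquad a b r = 0 -> hrec a1 b1 r = 0 -> base_res a b a1 b1 = 0.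
Proof.
move=> hr Nr; have r0 : r != 0.
  apply: contra_eq_neq Nr => ->.
  by rewrite /hrec expr0n !mulr0 !add0r oner_neq0.
have E1 : (b1 - a1 * b) * r + (1 - a * a1) = 0.
  transitivity (hrec a1 b1 r - a1 * hquad a b r);
    first by rewrite /hrec /hquad; ring.
  by rewrite hr Nr; ring.
have E2 : (1 - a * a1) * r + (b - a * b1) = 0.
  apply: (mulfI r0); transitivity (hquad a b r - a * hrec a1 b1 r).
    by rewrite /hrec /hquad; ring.
  by rewrite hr Nr; ring.
transitivity ((1 - a * a1) * ((b1 - a1 * b) * r + (1 - a * a1))
   - (b1 - a1 * b) * ((1 - a * a1) * r + (b - a * b1))).
  by rewrite /base_res; ring.
by rewrite E1 E2; ring.
Qed.

(** The branch discriminant as a polynomial in the parameter of the pencil. *)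
Definition branch_poly (R : comNzRingType) (a b a1 b1 : R) : {poly R} :=
  branch_disc a%:P b%:P a1%:P b1%:P 'X.

Lemma rmorph_branch_disc (R S : comNzRingType) (f : {rmorphism R -> S}) (a b a1
  b1 c : R) :
  f (branch_disc a b a1 b1 c) = branch_disc (f a) (f b) (f a1) (f b1) (f c).
Proof. by rewrite /branch_disc; ring. Qed.

Lemma rmorph_branch_disc' (R S : comNzRingType) (f : {rmorphism R -> S}) (a b
  a1 b1 c : R) :
  f (branch_disc' a b a1 b1 c) = branch_disc' (f a) (f b) (f a1) (f b1) (f c).
Proof. by rewrite /branch_disc'; ring. Qed.

Lemma rmorph_branch_disc'' (R S : comNzRingType) (f : {rmorphism R -> S}) (a b
  a1 b1 c : R) :
  f (branch_disc'' a b a1 b1 c) = branch_disc'' (f a) (f b) (f a1) (f b1) (f c).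
Proof. by rewrite /branch_disc''; ring. Qed.

Section BranchPoly.

Variables (R : comNzRingType) (a b a1 b1 : R).

Lemma horner_branch_poly c : (branch_poly a b a1 b1).[c] = branch_disc a b a1
  b1 c.
Proof.
rewrite -[LHS]/(horner_eval c _) rmorph_branch_disc /= !horner_evalE.
by rewrite !hornerC hornerX.
Qed.

Lemma deriv_branch_poly :
  (branch_poly a b a1 b1)^`() = branch_disc' a%:P b%:P a1%:P b1%:P 'X.
Proof.
rewrite /branch_poly /branch_disc /branch_disc' -!polyC_natr ![_ ^+ 3]exprS ![_
  ^+ 2]expr2.
rewrite !(derivD, derivN, derivM, derivC, derivX).
by ring.
Qed.

Lemma deriv2_branch_poly :
  (branch_poly a b a1 b1)^`()^`() = branch_disc'' a%:P b%:P a1%:P b1%:P 'X.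
Proof.
rewrite deriv_branch_poly /branch_disc' /branch_disc''.
rewrite -!polyC_natr ![_ ^+ 3]exprS ![_ ^+ 2]expr2.
rewrite !(derivD, derivN, derivM, derivC, derivX).
by ring.
Qed.

Lemma horner_deriv_branch_poly c :
  (branch_poly a b a1 b1)^`().[c] = branch_disc' a b a1 b1 c.
Proof.
rewrite deriv_branch_poly -[LHS]/(horner_eval c _) rmorph_branch_disc' /=
  !horner_evalE.
by rewrite !hornerC hornerX.
Qed.

Lemma horner_deriv2_branch_poly c :
  (branch_poly a b a1 b1)^`()^`().[c] = branch_disc'' a b a1 b1 c.
Proof.
rewrite deriv2_branch_poly -[LHS]/(horner_eval c _) rmorph_branch_disc'' /=
  !horner_evalE.
by rewrite !hornerC hornerX.
Qed.

End BranchPoly.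

Lemma branch_polyE (R : comNzRingType) (a b a1 b1 : R) :
  branch_poly a b a1 b1 = Poly [:: a1 ^+ 2 * (b1 ^+ 2 - 4%:R * a1);
    - 2%:R * a1 * b1 * (a * a1 + b * b1) - 18%:R * a1 * b1
      + 12%:R * a1 ^+ 2 * b + 4%:R * b1 ^+ 3;
    (a * a1 + b * b1) ^+ 2 + 2%:R * a * b * a1 * b1 + 18%:R * (a * a1 + b * b1)
      - 27%:R - 12%:R * a * b1 ^+ 2 - 12%:R * a1 * b ^+ 2;
    - 2%:R * a * b * (a * a1 + b * b1) - 18%:R * a * b
      + 12%:R * a ^+ 2 * b1 + 4%:R * b ^+ 3;
    a ^+ 2 * (b ^+ 2 - 4%:R * a)].
Proof. by rewrite /= !cons_poly_def /branch_poly /branch_disc; ring. Qed.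

Lemma closed_root2 (L : closedFieldType) (a b : L) :
  exists r, r ^+ 2 = a + b * r.
Proof.
have [r rE] := GRing.solve_monicpoly 2 (nth 0 [:: a; b]) isT.
by exists r; rewrite rE !big_ord_recl big_ord0 /=; ring.
Qed.

Lemma closed_root3 (L : closedFieldType) (a b c : L) :
  exists r, r ^+ 3 = a + b * r + c * r ^+ 2.
Proof.
have [r rE] := GRing.solve_monicpoly 3 (nth 0 [:: a; b; c]) isT.
by exists r; rewrite rE !big_ord_recl big_ord0 /=; ring.
Qed.

Section ClosedField.

Variables (L : closedFieldType) (a b a1 b1 : L).
Hypothesis two0 : 2%:R != 0 :> L.

Lemma branch_disc_double c : c != 0 -> branch_disc a b a1 b1 c = 0 ->
  exists r s, [/\ a1 - b * c = c * (2%:R * r + s),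
    b1 - a * c = - c * (r ^+ 2 + 2%:R * r * s) & 1 = c * (r ^+ 2 * s)].
Proof.
move=> c0 D0.
have [x xE] := closed_root3 c^-1 ((b1 - a * c) / c) ((a1 - b * c) / c).
pose e := (a1 - b * c) / c - x.
have [y yE] := closed_root2 ((b1 - a * c) / c + e * x) e.
pose s := e - y.
have bE : a1 - b * c = c * (x + y + s).
  by rewrite /s /e; field.
have gE : b1 - a * c = - c * (x * y + x * s + y * s).
  have -> : b1 - a * c = c * (y ^+ 2 - e * y - e * x) by rewrite yE; field.
  by rewrite /s; ring.
have dE : 1 = c * (x * y * s).
  have -> : 1 = c * (x ^+ 3 - (b1 - a * c) / c * x - (a1 - b * c) / c * x ^+ 2).
    by rewrite xE; field.
  by rewrite bE gE; field.
have : c ^+ 4 * ((x - y) * (x - s) * (y - s)) ^+ 2 == 0.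
  apply/eqP; rewrite -[RHS]D0 /branch_disc bE gE.
  transitivity ((c * (x + y + s)) ^+ 2 * (- c * (x * y + x * s + y * s)) ^+ 2
    + 4%:R * c * (- c * (x * y + x * s + y * s)) ^+ 3
    - 4%:R * (c * (x + y + s)) ^+ 3 * (c * (x * y * s))
    - 27%:R * c ^+ 2 * (c * (x * y * s)) ^+ 2
    - 18%:R * c * (c * (x + y + s)) * (- c * (x * y + x * s + y * s)) * (c * (x
      * y * s))).
    by ring.
  by rewrite -dE; ring.
rewrite mulf_eq0 expf_eq0 (negPf c0) /= sqrf_eq0 !mulf_eq0 !subr_eq0.
case/orP => [/orP[]|] /eqP E.
- by exists x, s; split; rewrite ?bE ?gE ?[LHS]dE -E; ring.
- by exists x, y; split; rewrite ?bE ?gE ?[LHS]dE -E; ring.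
- by exists y, x; split; rewrite ?bE ?gE ?[LHS]dE -E; ring.
Qed.

Hypothesis res0 : base_res a b a1 b1 != 0.

(** A multiple root of the branch discriminant is a point of total branching. *)
Lemma triple_rootP c : c != 0 -> branch_disc a b a1 b1 c = 0 ->
  branch_disc' a b a1 b1 c = 0 ->
  exists2 r, triple_root a b a1 b1 c r & r * hquad a b r != 0.
Proof.
move=> c0 D0; have [r [s [bE gE dE]]] := branch_disc_double c0 D0.
rewrite (branch_disc'_double bE gE dE).
have r0 : r != 0.
  by apply: contra_eq_neq dE => ->; rewrite expr0n mul0r mulr0 oner_neq0.
have hr : hquad a b r != 0.
  apply: contra_neq res0 => hr; apply: (base_res0 hr).
  transitivity (c * r * hquad a b r + (- c * r ^+ 3 + (a1 - b * c) * r ^+ 2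
     + (b1 - a * c) * r + 1)); first by rewrite /hrec /hquad; ring.
  have z0 : 1 - c * (r ^+ 2 * s) = 0 by rewrite -dE subrr.
  by rewrite hr bE gE -[RHS]z0; ring.
have rh : r * hquad a b r != 0 by rewrite mulf_neq0.
have k0 : - 4%:R * c ^+ 3 != 0 by rewrite mulf_neq0 ?oppr_eq0 ?four_neq0
  ?expf_neq0.
move/eqP; rewrite mulf_eq0 (negPf rh) orbF mulf_eq0 (negPf k0) expf_eq0
  subr_eq0 /=.
move/eqP => rs; exists r => //.
by split; rewrite ?bE ?gE ?[LHS]dE -rs; ring.
Qed.

(** The three coefficients of the Hessian of the cubic vanish at a triple root. *)
Lemma hessian0 c r : triple_root a b a1 b1 c r ->
  [/\ (b ^+ 2 - 3%:R * a) * c ^+ 2 + (3%:R * b1 - 2%:R * a1 * b) * c + a1 ^+ 2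
    = 0,
      a * b * c ^+ 2 + (9%:R - a * a1 - b * b1) * c + a1 * b1 = 0
    & a ^+ 2 * c ^+ 2 + (3%:R * b - 2%:R * a * b1) * c + (b1 ^+ 2 - 3%:R * a1)
      = 0].
Proof.
case=> bE gE dE; split.
- transitivity ((a1 - b * c) ^+ 2 + 3%:R * c * (b1 - a * c)); first by ring.
  by rewrite bE gE; ring.
- transitivity ((a1 - b * c) * (b1 - a * c) + 9%:R * c * (c * r ^+ 3)).
    by rewrite -dE; ring.
  by rewrite bE gE; ring.
- transitivity ((b1 - a * c) ^+ 2 - 3%:R * (a1 - b * c) * (c * r ^+ 3)).
    by rewrite -dE; ring.
  by rewrite bE gE; ring.
Qed.

End ClosedField.

(** Two quadratics with two common roots are proportional. *)
Lemma proportional_quadratics (K : fieldType) (p0 p1 p2 q0 q1 q2 c1 c2 : K) :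
  c1 != c2 ->
  p2 * c1 ^+ 2 + p1 * c1 + p0 = 0 -> p2 * c2 ^+ 2 + p1 * c2 + p0 = 0 ->
  q2 * c1 ^+ 2 + q1 * c1 + q0 = 0 -> q2 * c2 ^+ 2 + q1 * c2 + q0 = 0 ->
  p2 * q0 = q2 * p0.
Proof.
have constE (r0 r1 r2 : K) : c1 != c2 ->
    r2 * c1 ^+ 2 + r1 * c1 + r0 = 0 -> r2 * c2 ^+ 2 + r1 * c2 + r0 = 0 ->
    r0 = c1 * c2 * r2.
  rewrite -subr_eq0 => c12 E1 E2; apply: (mulfI c12).
  apply/eqP; rewrite -subr_eq0; apply/eqP.
  transitivity (c1 * (r2 * c2 ^+ 2 + r1 * c2 + r0) - c2 * (r2 * c1 ^+ 2 + r1 *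
    c1 + r0)).
    by ring.
  by rewrite E1 E2; ring.
by move=> c12 P1 P2 Q1 Q2;
  rewrite (constE _ _ _ c12 P1 P2) (constE _ _ _ c12 Q1 Q2); ring.
Qed.

(** If every root of the branch discriminant is multiple, the rational function
    is totally ramified at two points, or, in characteristic three, at a single
    one.  In the first case the three coefficients of the Hessian, quadratics in c
    with two common roots, are proportional. *)
Lemma total_branching (L : closedFieldType) (a b a1 b1 : L) :
  2%:R != 0 :> L -> base_res a b a1 b1 != 0 -> a != 0 -> a1 != 0 ->
  b ^+ 2 - 4%:R * a != 0 -> b1 ^+ 2 - 4%:R * a1 != 0 -> (b == 0) = (b1 == 0) ->
  branch_poly a b a1 b1 %| ('X * (branch_poly a b a1 b1)^`()) ^+ 2 ->
  [/\ 3%:R != 0 :> L, b = 0 & a * a1 = 9%:R] \/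
  [/\ b != 0, a * b1 ^+ 2 = a1 * b ^+ 2 & b ^+ 3 - a ^+ 2 * b1 - 3%:R * a * b =
    0].
Proof.
move=> two0 res0 a0 a10 d4 d0 bb1 dvdD; set D := branch_poly a b a1 b1 in dvdD.
have sizeD : size D = 5.
  rewrite /D branch_polyE (@PolyK _ 0) //=.
  by rewrite mulf_neq0 ?expf_neq0.
have tri c : root D c -> c != 0 /\
    exists2 r, triple_root a b a1 b1 c r & r * hquad a b r != 0.
  move=> rc; have Dc : branch_disc a b a1 b1 c = 0.
    by rewrite -horner_branch_poly; apply/rootP.
  have c0 : c != 0.
    apply: contra_eq_neq Dc => ->.
    have -> : branch_disc a b a1 b1 0 = a1 ^+ 2 * (b1 ^+ 2 - 4%:R * a1).
      by rewrite /branch_disc; ring.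
    by rewrite mulf_neq0 ?expf_neq0.
  split=> //; apply: triple_rootP => //; rewrite -horner_deriv_branch_poly.
  have : root (('X * D^`()) ^+ 2) c.
    by case/dvdpP: dvdD => G ->; rewrite rootM rc orbT.
  by rewrite /root horner_exp hornerM hornerX sqrf_eq0 mulf_eq0 (negPf c0) =>
    /eqP.
have /closed_rootP[c1 rc1] : size D != 1 by rewrite sizeD.
have [c10 [r1 t1 M1]] := tri _ rc1.
have [three0|three0] := eqVneq (3%:R : L) 0.
  have lin c : root D c -> b1 = a * c /\ a1 = b * c.
    case/tri => _ [r [bE gE _] _]; split; apply/eqP; rewrite -subr_eq0.
      by rewrite gE three0 !mul0r oppr0.
    by rewrite bE three0 !mul0r.
  have [b1E a1E] := lin _ rc1.
  have b0 : b != 0 by apply: contraNneq a10 => b0; rewrite a1E b0 mul0r.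
  have four1 : 4%:R = 1 :> L by rewrite (natrD _ 3 1) three0 add0r.
  have l0 : a ^+ 2 * b ^+ 2 - a ^+ 3 != 0.
    have -> : a ^+ 2 * b ^+ 2 - a ^+ 3 = a ^+ 2 * (b ^+ 2 - 1 * a) by ring.
    by rewrite -four1 mulf_neq0 ?expf_neq0.
  (* The discriminant is (c - c1)^3 times a linear polynomial in c. *)
  pose c2 := (a ^+ 2 * b ^+ 2 * c1 - b ^+ 3) / (a ^+ 2 * b ^+ 2 - a ^+ 3).
  have c2E : (a ^+ 2 * b ^+ 2 - a ^+ 3) * c2 = a ^+ 2 * b ^+ 2 * c1 - b ^+ 3.
    by rewrite mulrC divfK.
  have rc2 : root D c2.
    rewrite /root horner_branch_poly; apply/eqP.
    transitivity ((c2 - c1) ^+ 3 * ((a ^+ 2 * b ^+ 2 - a ^+ 3) * c2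
        - a ^+ 2 * b ^+ 2 * c1 + b ^+ 3)
      + 3%:R * (c2 * a ^+ 3 * (c1 - c2) ^+ 3 - b ^+ 3 * (c1 - c2) ^+ 3
         - 9%:R * c2 ^+ 2 - 6%:R * c2 * a * b * (c1 - c2) ^+ 2)).
      by rewrite /branch_disc b1E a1E; ring.
    by rewrite three0 c2E; ring.
  have [b1E2 _] := lin _ rc2.
  have c12 : c2 = c1 by apply: (mulfI a0); rewrite -b1E.
  have E : b ^+ 3 = a ^+ 3 * c1.
    apply/eqP; rewrite -subr_eq0; apply/eqP.
    have := c2E; rewrite c12 => E; transitivity ((a ^+ 2 * b ^+ 2 - a ^+ 3) * c1
      - (a ^+ 2 * b ^+ 2 * c1 - b ^+ 3)); first by ring.
    by rewrite E subrr.
  right; split=> //.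
    by rewrite b1E a1E; transitivity (a ^+ 3 * c1 * c1); [|rewrite -E]; ring.
  by rewrite b1E E three0; ring.
have six0 : 54%:R != 0 :> L by rewrite (natrM _ 2 27) (natrM _ 3 9) (natrM _ 3
  3) !mulf_neq0.
have [c2 [rc2 c12]] : exists c2, root D c2 /\ c1 != c2.
  have rD1 : D^`().[c1] = 0.
    case: t1 => bE gE dE.
    rewrite horner_deriv_branch_poly (@branch_disc'_double _ _ _ _ _ c1 r1 r1).
    - by rewrite subrr; ring.
    - by rewrite bE; ring.
    - by rewrite gE; ring.
    - by rewrite [LHS]dE; ring.
  have /factor_theorem[G1 G1E] := rc1.
  have /factor_theorem[G GE] : root G1 c1.
    move: rD1; rewrite G1E derivM derivXsubC hornerD !hornerM hornerXsubC subrr.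
    by rewrite mulr0 add0r hornerC mulr1 => /eqP.
  have G10 : G1 != 0 by apply: contra_eq_neq sizeD => G10;
    rewrite G1E G10 mul0r size_poly0.
  have sizeG : size G != 1.
    move: sizeD; rewrite G1E size_Mmonic ?monicXsubC // size_XsubC addn2 /= =>
      -[].
    have G0 : G != 0 by apply: contra_neq G10 => G0; rewrite GE G0 mul0r.
    by rewrite GE size_Mmonic ?monicXsubC // size_XsubC addn2 /= => -[] ->.
  have /closed_rootP[c2 rc2] := sizeG.
  exists c2; split; first by rewrite G1E GE !rootM rc2.
  apply/eqP => c12; move: rc2; rewrite -c12 => rG.
  have : D^`()^`().[c1] = 0.
    rewrite G1E GE !(derivXsubC, derivM, derivD, derivC).
    rewrite !(hornerXsubC, hornerD, hornerM, hornerC) subrr (rootP rG); ring.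
  rewrite horner_deriv2_branch_poly.
  case: t1 => bE gE dE.
  have -> : branch_disc'' a b a1 b1 c1 = - 54%:R * c1 ^+ 2 * (r1 * hquad a b
    r1) ^+ 2.
    apply: (branch_disc''_triple (s := r1)) => //.
    - by rewrite bE; ring.
    - by rewrite gE; ring.
    - by rewrite [LHS]dE; ring.
  have n54 : - 54%:R != 0 :> L by rewrite oppr_eq0.
  by apply/eqP; apply: mulf_neq0 (mulf_neq0 n54 _) _; apply: expf_neq0.
have [_ [r2 t2 _]] := tri _ rc2.
have [A1 B1 C1] := hessian0 t1; have [A2 B2 C2] := hessian0 t2.
have AB := proportional_quadratics c12 A1 A2 B1 B2.
have CB := proportional_quadratics c12 C1 C2 B1 B2.
have AC := proportional_quadratics c12 A1 A2 C1 C2.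
have [b0|b0] := eqVneq b 0.
  have b10 : b1 = 0 by apply/eqP; rewrite -bb1 b0.
  left; split=> //; apply: (mulfI (mulf_neq0 a0 a10)).
  transitivity (a ^+ 2 * a1 ^+ 2); first by ring.
  by rewrite -AC b0 b10; ring.
have b10 : b1 != 0 by rewrite -bb1.
have E1 : (b ^+ 2 - 3%:R * a) * b1 = a * a1 * b.
  by apply: (mulfI a10); transitivity ((b ^+ 2 - 3%:R * a) * (a1 * b1));
    [|rewrite AB]; ring.
have E2 : a * a1 * b1 = (b1 ^+ 2 - 3%:R * a1) * b.
  by apply: (mulfI a0); transitivity (a ^+ 2 * (a1 * b1)); [|rewrite CB]; ring.
have E3 : a * b1 ^+ 2 = a1 * b ^+ 2.
  apply: (mulfI three0); apply/eqP; rewrite -subr_eq0; apply/eqP.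
  transitivity (b1 * (a * a1 * b - (b ^+ 2 - 3%:R * a) * b1)
     - b * (a * a1 * b1 - (b1 ^+ 2 - 3%:R * a1) * b)); first by ring.
  by rewrite E1 E2; ring.
right; split=> //.
apply: (mulfI b10); rewrite mulr0.
transitivity (b * ((b ^+ 2 - 3%:R * a) * b1) - a * (a * b1 ^+ 2)); first by ring.
by rewrite E1 E3; ring.
Qed.

(** * Necessity *)

(** With t = a/b^2 and t = a1/b1^2, and under the closing relation between t
    and the norm b b1, the branch discriminant is a constant times a square. *)
Lemma branch_disc_square (K : fieldType) (t b b1 c : K) :
  t != 0 -> b != 0 -> b * b1 * t ^+ 2 = 1 - 3%:R * t ->
  branch_disc (t * b ^+ 2) b (t * b1 ^+ 2) b1 c =
  (t * b ^+ 2) ^+ 2 * (b ^+ 2 - 4%:R * (t * b ^+ 2)) *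
  (c ^+ 2 + (9%:R - t * b ^+ 2 * (t * b1 ^+ 2) - b * b1) / (t * b ^+ 2 * b) * c
   + t * b1 ^+ 2 * b1 / (t * b ^+ 2 * b)) ^+ 2.
Proof.
move=> t0 b0 nE.
have -> : b1 = (1 - 3%:R * t) / (b * t ^+ 2).
  by rewrite -nE; field; rewrite b0 t0.
by rewrite /branch_disc; field; rewrite b0 t0.
Qed.

Section Necessity.

Variables (F : finFieldType) (q : nat) (cj : {rmorphism F -> F}).
Hypotheses (cardF : #|F| = (q ^ 2)%N) (q_odd : odd q) (q_gt1 : (1 < q)%N).
Hypothesis cjE : forall x, cj x = x ^+ q.
Hypotheses (two0 : 2%:R != 0 :> F) (qF : q%:R = 0 :> F).
Variables a b : F.

Local Notation h := (hquad a b).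
Local Notation a1 := (cj a).
Local Notation b1 := (cj b).
Local Notation cjK := (cjK cardF cjE).
Let four0 : 4%:R != 0 :> F := four_neq0 two0.
Let m := (q.+1 %/ 2)%N.
Let mE : (2 * m)%N = q.+1. Proof. by rewrite /m; lia. Qed.

Hypothesis h0 : forall y, unitary cj y -> h y != 0.

(** If h, without roots on the unit circle, has a common root with its
    reciprocal, then the two are proportional. *)
Lemma selfrec_of_res0 : base_res a b a1 b1 = 0 -> a * a1 = 1 /\ b = a * b1.
Proof.
rewrite /base_res => res0.
have cl : cj (b1 - a1 * b) = b - a * b1.
  by rewrite rmorphB rmorphM /= !cjK.
have bE : b = a * b1.
  apply/eqP; rewrite -subr_eq0; apply/negPn/negP => l0.
  have l10 : b1 - a1 * b != 0 by rewrite -(fmorph_eq0 cj) cl.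
  pose r := (a * a1 - 1) / (b1 - a1 * b).
  have ur : unitary cj r.
    rewrite /unitary fmorph_div cl rmorphB rmorphM rmorph1 /= cjK.
    apply/eqP; transitivity ((1 - a * a1) ^+ 2 / ((b - a * b1) * (b1 - a1 * b))).
      by rewrite /r; field; rewrite l0 l10.
    move/eqP: res0; rewrite subr_eq0 => /eqP ->.
    by rewrite divff // mulf_neq0.
  have /eqP[] := h0 ur.
  transitivity (((1 - a * a1) ^+ 2 - (b - a * b1) * (b1 - a1 * b)) / (b1 - a1 *
    b) ^+ 2).
    by rewrite /hquad /r; field.
  by rewrite res0 mul0r.
split=> //; move/eqP: res0; rewrite -bE subrr mul0r subr0 sqrf_eq0 subr_eq0.
by move/eqP.
Qed.

Lemma selfrec_square : b != 0 -> a = b / b1 ->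
  exists d, [/\ d != 0, cj d = d & 1 - 4%:R * a / b ^+ 2 = d ^+ 2].
Proof.
move=> b0 aE; have b10 : b1 != 0 by rewrite fmorph_eq0.
have [w wE] : exists w, 1 - 4%:R * a / b ^+ 2 = w ^+ 2.
  apply: (sqrt_cj cardF q_odd q_gt1 cjE (unitary1 cj)).
  rewrite expr1n mulr1 aE !(rmorphD, rmorphN, rmorphXn, rmorphM, fmorphV,
    rmorph1, rmorph_nat) /=.
  by rewrite !cjK; field; rewrite b0 b10.
have cwN : cj w != - w.
  apply/eqP => cw; pose y := b * (w - 1) / 2%:R.
  have w2 : (1 - w ^+ 2) * (b * b1) = 4%:R by rewrite -wE aE; field;
    rewrite b0 b10.
  have uy : unitary cj y.
    rewrite /unitary /y fmorph_div !(rmorphM, rmorphD, rmorphN, rmorph1,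
      rmorph_nat) /= cw.
    apply/eqP; transitivity ((1 - w ^+ 2) * (b * b1) / 4%:R).
      by field; rewrite two0 four0.
    by rewrite w2 divff.
  have /eqP[] := h0 uy.
  transitivity (b ^+ 2 / 4%:R * (w ^+ 2 - (1 - 4%:R * a / b ^+ 2))).
    by rewrite /hquad /y; field; rewrite two0 four0 b0.
  by rewrite wE subrr mulr0.
have cw : cj w = w.
  have : cj w ^+ 2 == w ^+ 2.
    rewrite -rmorphXn /= -wE aE !(rmorphD, rmorphN, rmorphXn, rmorphM, fmorphV,
      rmorph1, rmorph_nat) /=.
    by rewrite !cjK; apply/eqP; field; rewrite b0 b10.
  by rewrite eqf_sqr (negPf cwN) orbF => /eqP.
exists w; split=> //.
by apply: contraNneq cwN => ->; rewrite rmorph0 oppr0.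
Qed.

Lemma selfrec_sign : b = 0 -> a * a1 = 1 -> (- a) ^+ m = -1.
Proof.
move=> b0 aa; have : ((- a) ^+ m) ^+ 2 == 1 ^+ 2.
  rewrite -exprM mulnC mE [_ ^+ q.+1]exprS -cjE rmorphN mulrNN aa expr1n //.
rewrite eqf_sqr => /orP[]/eqP // am.
have [y yE] : exists y, - a = y ^+ 2.
  by apply: (sqrt_half cardF) => //; rewrite mulnC exprM am expr1n.
have uy : unitary cj y by rewrite (unitaryE cjE) -mE exprM -yE am.
by have /eqP[] := h0 uy; rewrite /hquad b0 -yE; ring.
Qed.

(** A monic quadratic does not vanish on the whole unit circle, which has at least
    four points. *)
Lemma unitary_nonroot k1 k0 : exists2 c, unitary cj c & c ^+ 2 + k1 * c + k0 != 0.
Proof.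
have [K1|] := eqVneq (1 + k1 + k0) 0; last first.
  by exists 1; rewrite ?unitary1 // expr1n mulr1.
have [K2|] := eqVneq (1 - k1 + k0) 0; last first.
  by exists (-1); rewrite ?sqrrN ?expr1n ?mulrN1 // /unitary rmorphN rmorph1
    mulrNN mulr1.
have [z zP] := unitary_prim_root cardF q_odd q_gt1.
have k10 : k1 = 0.
  apply: (mulfI two0); transitivity ((1 + k1 + k0) - (1 - k1 + k0));
    first by ring.
  by rewrite K1 K2; ring.
exists z; first by rewrite (unitaryE cjE) (prim_expr_order zP).
have -> : z ^+ 2 + k1 * z + k0 = z ^+ 2 - 1 + (1 + k1 + k0) by rewrite k10; ring.
rewrite K1 addr0 subr_eq0 -(prim_order_dvd zP) gtnNdvd //; lia.
Qed.

Hypothesis inj : circle_injective cj a b.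

(* The quadratic character of the branch discriminant, when it is a constant
   times a square. *)
Let character_square kappa lambda k1 k0 :
  (forall c, branch_disc a b a1 b1 c = kappa * (c ^+ 2 + k1 * c + k0) ^+ 2) ->
  (forall c, unitary cj c -> cj (c ^+ 2 + k1 * c + k0)
     = lambda / c ^+ 2 * (c ^+ 2 + k1 * c + k0)) ->
  kappa ^+ m * lambda = kappa.
Proof.
move=> DE KE; have [c uc K0] := unitary_nonroot k1 k0.
have [+ _] := branch_disc_circle cardF q_odd q_gt1 cjE two0 h0 inj uc.
rewrite DE -/m exprMn -exprM mE [_ ^+ q.+1]exprS -cjE KE //.
set K := _ + _ in K0 *; move=> E; have c0 := unitary_neq0 uc.
apply: (mulIf (expf_neq0 2 K0)); rewrite -E; field; exact: c0.
Qed.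

Lemma nine_sign : 3%:R != 0 :> F -> b = 0 -> a * a1 = 9%:R -> (- a) ^+ m = 3%:R.
Proof.
move=> three0 b0 aa.
have nine0 : 9%:R != 0 :> F by rewrite (natrM _ 3 3) mulf_neq0.
have a0 : a != 0 by apply: contra_eq_neq aa => ->; rewrite mul0r eq_sym.
have a1E : a1 = 9%:R / a by rewrite -aa mulrAC divff // mul1r.
have t0 : 27%:R != 0 :> F by rewrite (natrM _ 3 9) mulf_neq0.
have E : (- 4%:R * a ^+ 3) ^+ m * (- a ^+ 3 / 27%:R) = - 4%:R * a ^+ 3.
  apply: (@character_square _ _ 0 (- 27%:R / a ^+ 3)).
    by move=> c; rewrite /branch_disc b0 rmorph0 a1E; field; exact: a0.
  move=> c uc; have c0 := unitary_neq0 uc.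
  rewrite mul0r addr0 rmorphD fmorph_div rmorphN rmorph_nat !rmorphXn /= a1E
    (unitary_cj uc).
  have t1 : 729%:R != 0 :> F by rewrite (natrM _ 27 27) mulf_neq0.
  by field; rewrite c0 a0 t0 t1.
have four_m : 4%:R ^+ m = 4%:R :> F.
  by rewrite (natrM _ 2 2) -expr2 -exprM mE [_ ^+ q.+1]exprS -cjE rmorph_nat.
have tt : ((- a) ^+ m) ^+ 2 = 9%:R.
  by rewrite -exprM mulnC mE [_ ^+ q.+1]exprS -cjE rmorphN mulrNN aa.
set t := (- a) ^+ m in tt *.
have ttt : 4%:R * (9%:R * t) * (- a ^+ 3 / 27%:R) = - 4%:R * a ^+ 3.
  rewrite -tt -exprSr -[X in X * _ ^+ 3]four_m /t -exprM [(m * 3)%N]mulnC exprM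
    -exprMn -[RHS]E.
  by congr (_ ^+ _ * _); ring.
have k0 : - 4%:R * a ^+ 3 / 3%:R != 0.
  by rewrite mulf_neq0 ?invr_eq0 // mulf_neq0 ?oppr_eq0 // expf_neq0.
apply: (mulfI k0); transitivity (4%:R * (9%:R * t) * (- a ^+ 3 / 27%:R)).
  by field; rewrite three0 t0.
by rewrite ttt; field.
Qed.

Lemma total_branching_square : a != 0 -> b != 0 -> b ^+ 2 - 4%:R * a != 0 ->
  a * b1 ^+ 2 = a1 * b ^+ 2 -> b ^+ 3 - a ^+ 2 * b1 - 3%:R * a * b = 0 ->
  exists d, [/\ d != 0, cj d = d & 1 - 4%:R * a / b ^+ 2 = d ^+ 2].
Proof.
move=> a0 b0 d4 aR bE.
have a10 : a1 != 0 by rewrite fmorph_eq0.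
have b10 : b1 != 0 by rewrite fmorph_eq0.
have tR : a1 / b1 ^+ 2 = a / b ^+ 2.
  by apply/eqP; rewrite eqr_div ?expf_neq0 // aR.
have [w wE] : exists w, 1 - 4%:R * a / b ^+ 2 = w ^+ 2.
  apply: (sqrt_cj cardF q_odd q_gt1 cjE (unitary1 cj)).
  rewrite expr1n mulr1 -(mulrA 4%:R a) rmorphB rmorph1.
  by rewrite rmorphM rmorph_nat fmorph_div rmorphXn /= tR.
have w0 : w != 0.
  rewrite -sqrf_eq0 -wE; apply: contra_neq d4 => E.
  transitivity (b ^+ 2 * (1 - 4%:R * a / b ^+ 2)); last by rewrite E mulr0.
  by field.
exists w; split=> //.
have kE : a ^+ 2 * (b ^+ 2 - 4%:R * a) = (a * b * w) ^+ 2.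
  by rewrite exprMn -wE; field.
have E : (a ^+ 2 * (b ^+ 2 - 4%:R * a)) ^+ m * (a * b / (a1 * b1)) =
    a ^+ 2 * (b ^+ 2 - 4%:R * a).
  apply: (@character_square _ _ ((9%:R - a * a1 - b * b1) / (a * b)) (a1 * b1 /
    (a * b))).
    move=> c; pose t := a / b ^+ 2.
    have aE : a = t * b ^+ 2 by rewrite divfK // expf_neq0.
    have a1E : a1 = t * b1 ^+ 2 by rewrite /t -tR divfK // expf_neq0.
    have t0 : t != 0 by rewrite mulf_neq0 ?invr_eq0 ?expf_neq0.
    have nE : b * b1 * t ^+ 2 = 1 - 3%:R * t.
      apply/eqP; rewrite -subr_eq0; apply/eqP.
      transitivity (- (b ^+ 3 - a ^+ 2 * b1 - 3%:R * a * b) / b ^+ 3).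
        by rewrite /t; field.
      by rewrite bE oppr0 mul0r.
    by have := branch_disc_square c t0 b0 nE; rewrite -aE -a1E.
  move=> c uc; have c0 := unitary_neq0 uc.
  rewrite !(rmorphD, rmorphN, fmorph_div, rmorphXn, rmorphM, rmorph_nat) /=
    !cjK (unitary_cj uc).
  by field; rewrite c0 a0 b0 a10 b10.
have k0 : (a * b) ^+ 2 * w != 0 by rewrite mulf_neq0 // expf_neq0 // mulf_neq0.
apply: (mulfI k0); transitivity ((a * b * w) ^+ 2); last by ring.
rewrite -kE -E kE -exprM mE [_ ^+ q.+1]exprS -cjE !rmorphM /=.
by field; rewrite a10 b10.
Qed.

End Necessity.

Section BranchLocus.

Variables (F : finFieldType) (q : nat) (cj : {rmorphism F -> F}).
Hypotheses (cardF : #|F| = (q ^ 2)%N) (q_odd : odd q) (q_gt1 : (1 < q)%N).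
Hypothesis cjE : forall x, cj x = x ^+ q.
Hypotheses (two0 : 2%:R != 0 :> F) (qF : q%:R = 0 :> F).
Variables a b : F.

Local Notation h := (hquad a b).
Local Notation a1 := (cj a).
Local Notation b1 := (cj b).
Local Notation cjK := (cjK cardF cjE).
Let four0 : 4%:R != 0 :> F := four_neq0 two0.

Hypothesis h0 : forall y, unitary cj y -> h y != 0.
Hypothesis inj : circle_injective cj a b.
Hypothesis res0 : base_res a b a1 b1 != 0.

(** The roots of the branch discriminant are taken in an algebraic closure.  When
    its leading coefficient vanishes, so does its constant term, being the
    conjugate; then the coefficient of degree three vanishes too, which leaves
    a = b = 0 or a root - b / 2 of h on the unit circle. *)
Lemma branch_locus : (4 < q)%N -> (a != 0) || (b != 0) ->
  [/\ 3%:R != 0 :> F, b = 0 & a * a1 = 9%:R] \/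
  [/\ a != 0, b != 0, b ^+ 2 - 4%:R * a != 0, a * b1 ^+ 2 = a1 * b ^+ 2
    & b ^+ 3 - a ^+ 2 * b1 - 3%:R * a * b = 0].
Proof.
move=> q_gt4 ab0; pose D := branch_poly a b a1 b1.
have sizeD : (size D <= 5)%N by rewrite /D branch_polyE (size_Poly [:: _; _; _;
  _; _]).
have charD c : unitary cj c -> c ^+ 2 * D.[c] ^+ (q.+1 %/ 2) = D.[c].
  move=> uc; rewrite /D horner_branch_poly.
  by case: (branch_disc_circle cardF q_odd q_gt1 cjE two0 h0 inj uc).
have doubleD c : unitary cj c -> D.[c] = 0 -> D^`().[c] = 0.
  move=> uc; rewrite /D horner_branch_poly horner_deriv_branch_poly.
  case: (branch_disc_circle cardF q_odd q_gt1 cjE two0 h0 inj uc) => _ tri /tri.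
  case=> r [bE gE dE]; rewrite (@branch_disc'_double _ _ _ _ _ c r r).
  - by rewrite subrr; ring.
  - by rewrite bE; ring.
  - by rewrite gE; ring.
  - by rewrite [LHS]dE; ring.
have [dvdD [w [w1 w3]]] :=
  constant_character_quartic cardF q_odd q_gt1 cjE qF q_gt4 sizeD charD doubleD.
have d4 : a ^+ 2 * (b ^+ 2 - 4%:R * a) != 0.
  apply/eqP => d4; move: w3.
  rewrite /D branch_polyE !coef_Poly /= d4 mulr0 => /eqP;
    rewrite sqrf_eq0 => /eqP d3.
  move/eqP: d4; rewrite mulf_eq0 sqrf_eq0 => /orP[/eqP a0|].
    have : 4%:R * b ^+ 3 = 0 by rewrite -d3 a0 rmorph0; ring.
    move/eqP; rewrite mulf_eq0 (negPf four0) expf_eq0 /= => b0.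
    by move: ab0; rewrite a0 b0 eqxx.
  rewrite subr_eq0 => /eqP b2.
  have aE : a = b ^+ 2 / 4%:R by rewrite b2 mulrC mulKf.
  have a1E : a1 = b1 ^+ 2 / 4%:R by rewrite aE fmorph_div rmorphXn rmorph_nat.
  have b0 : b != 0.
    by apply: contraTneq ab0 => b0; rewrite b0 eqxx aE b0 expr0n mul0r eqxx.
  have nE : b * b1 = 4%:R.
    have : b ^+ 3 * (b * b1 - 4%:R) ^+ 2 = 0.
      transitivity (- 32%:R * (- 2%:R * a * b * (a * a1 + b * b1) - 18%:R * a * b
        + 12%:R * a ^+ 2 * b1 + 4%:R * b ^+ 3)).
        by rewrite a1E aE; field.
      by rewrite d3 mulr0.
    by move/eqP; rewrite mulf_eq0 !expf_eq0 /= (negPf b0) subr_eq0 => /eqP.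
  have uy : unitary cj (- b / 2%:R).
    rewrite /unitary fmorph_div rmorphN rmorph_nat; apply/eqP.
    by transitivity (b * b1 / 4%:R); [field;
      rewrite four0 two0 | rewrite nE divff].
  have /eqP[] := h0 uy; rewrite /hquad aE; field; rewrite four0 two0 //.
have [a0 b24] : a != 0 /\ b ^+ 2 - 4%:R * a != 0.
  by move: d4; rewrite mulf_eq0 sqrf_eq0 negb_or => /andP.
have [L [f _]] := countable_algebraic_closure F.
have fD : map_poly f D = branch_poly (f a) (f b) (f a1) (f b1).
  by rewrite /D /branch_poly rmorph_branch_disc /= !map_polyC map_polyX.
have f4 : f (b ^+ 2 - 4%:R * a) != 0 by rewrite fmorph_eq0.
have f41 : f (b1 ^+ 2 - 4%:R * a1) != 0.
  by rewrite fmorph_eq0 -(fmorph_eq0 cj) !(rmorphB, rmorphXn, rmorphM,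
    rmorph_nat) /= !cjK.
have fres : base_res (f a) (f b) (f a1) (f b1) = f (base_res a b a1 b1).
  by rewrite /base_res; ring.
have := @total_branching L (f a) (f b) (f a1) (f b1).
rewrite fres !fmorph_eq0 -fD deriv_map -(rmorph_nat f 2) fmorph_eq0.
move=> /(_ two0 res0 a0 a0);
  rewrite !(rmorphB, rmorphXn, rmorphM, rmorph_nat) in f4.
rewrite !(rmorphB, rmorphXn, rmorphM, rmorph_nat) in f41.
move=> /(_ f4 f41 erefl).
have -> : map_poly f D %| ('X * map_poly f D^`()) ^+ 2.
  have -> : ('X * map_poly f D^`()) ^+ 2 = map_poly f (('X * D^`()) ^+ 2).
    by rewrite rmorphXn rmorphM /= map_polyX.
  by rewrite dvdp_map.
case=> // [[three0 b0 aa]|[b0 E1 E2]].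
  left; split.
  - by rewrite -(fmorph_eq0 f) rmorph_nat.
  - by apply/eqP; rewrite -(fmorph_eq0 f) b0.
  - by apply: (fmorph_inj f); rewrite rmorphM rmorph_nat.
right; split=> //; apply: (fmorph_inj f).
- by rewrite !(rmorphXn, rmorphM) /=.
- by rewrite [RHS]rmorph0 !(rmorph_nat, rmorphD, rmorphN, rmorphXn, rmorphM) /=.
Qed.

(** For q = 3 the unit circle consists of the fourth roots of unity 1, -1, i, -i.
    At each such c, either D(c) = c^2, or D(c) = 0 with b1 = a c and a1 = b c;
    the presence of a zero forces a = b = 0, and its absence is contradictory. *)
Lemma branch_locus_three : q = 3 -> a = 0 /\ b = 0.
Proof.
move=> q3; have three0 : 3%:R = 0 :> F by rewrite -qF q3.
have four1 : 4%:R = 1 :> F by rewrite (natrD _ 3 1) three0 add0r.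
have cj3 x : cj x = x ^+ 3 by rewrite cjE q3.
have x9 (x : F) : x ^+ 9 = x by rewrite -[RHS]cjK !cj3 -exprM.
have x8 (x : F) : x != 0 -> x ^+ 8 = 1.
  by move=> x0; apply: (mulfI x0); rewrite -exprS x9 mulr1.
have [i iP] := unitary_prim_root cardF q_odd q_gt1.
rewrite q3 in iP.
have i2 : i ^+ 2 = -1.
  have : (i ^+ 2) ^+ 2 == 1 ^+ 2 by rewrite -exprM (prim_expr_order iP) expr1n.
  rewrite eqf_sqr => /orP[|/eqP//].
  by rewrite -(prim_order_dvd iP).
have ui : unitary cj i by rewrite (unitaryE cjE) q3 (prim_expr_order iP).
have uN c : unitary cj c -> unitary cj (- c) by rewrite /unitary rmorphN mulrNN.
have i0 := unitary_neq0 ui.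
pose D := branch_disc a b a1 b1.
have circ c : unitary cj c -> (c ^+ 2 * D c = 1) \/
    [/\ D c = 0, b1 = a * c & a1 = b * c].
  move=> uc; case: (branch_disc_circle cardF q_odd q_gt1 cjE two0 h0 inj uc).
  rewrite q3 -/(D c) => E tri; have [D0|D0] := eqVneq (D c) 0; [right | left].
    case/tri: (D0) => r [bE gE _]; split=> //; apply/eqP; rewrite -subr_eq0.
      by rewrite gE three0 !mul0r oppr0.
    by rewrite bE three0 !mul0r.
  by apply: (mulIf D0); rewrite mul1r -[RHS]E -mulrA.
have DE c : D c = a1 ^+ 2 * (b1 ^+ 2 - a1)
    + (a1 * b1 * (a * a1 + b * b1) + b1 ^+ 3) * c
    + ((a * a1 + b * b1) ^+ 2 + 2%:R * a * b * a1 * b1) * c ^+ 2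
    + (a * b * (a * a1 + b * b1) + b ^+ 3) * c ^+ 3
    + a ^+ 2 * (b ^+ 2 - a) * c ^+ 4.
  (* The terms of D that are multiples of 3 are set apart. *)
  transitivity (a1 ^+ 2 * (b1 ^+ 2 - a1)
    + (a1 * b1 * (a * a1 + b * b1) + b1 ^+ 3) * c
    + ((a * a1 + b * b1) ^+ 2 + 2%:R * a * b * a1 * b1) * c ^+ 2
    + (a * b * (a * a1 + b * b1) + b ^+ 3) * c ^+ 3
    + a ^+ 2 * (b ^+ 2 - a) * c ^+ 4
    + 3%:R * (- a1 ^+ 3 + (- a1 * b1 * (a * a1 + b * b1) - 6%:R * a1 * b1
        + 4%:R * a1 ^+ 2 * b + b1 ^+ 3) * c
      + (6%:R * (a * a1 + b * b1) - 9%:R - 4%:R * a * b1 ^+ 2 - 4%:R * a1 * b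
        ^+ 2) * c ^+ 2
      + (- a * b * (a * a1 + b * b1) - 6%:R * a * b + 4%:R * a ^+ 2 * b1 + b ^+
        3) * c ^+ 3
      - a ^+ 3 * c ^+ 4)).
    by rewrite /D /branch_disc; ring.
  by rewrite three0 mul0r addr0.
have no_zero c : unitary cj c -> D c = 0 -> a = 0 /\ b = 0.
  move=> uc Dc; have c0 := unitary_neq0 uc.
  have c4 : c ^+ 4 = 1 by apply/eqP; have := uc; rewrite (unitaryE cjE) q3.
  case: (circ c uc) => [|[_ b1E a1E]].
    by rewrite Dc mulr0 => /eqP; rewrite eq_sym oner_eq0.
  have bE : b = a ^+ 3 * c ^+ 3.
    by rewrite -cj3 a1E -mulrA -exprS c4 mulr1.
  have [a0|a0] := eqVneq a 0; first by rewrite bE a0 expr0n mul0r.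
  have other d : unitary cj d -> d != c -> d ^+ 2 * D d = 1.
    move=> ud; case: (circ d ud) => // -[_ b1E2 _] /eqP[].
    by apply: (mulfI a0); rewrite -b1E.
  have DcE x : D x = (x - c) ^+ 3 * ((c ^+ 2 - a ^+ 3) * x - c ^+ 3 + a * c).
    transitivity ((x - c) ^+ 3 * ((a ^+ 2 * b ^+ 2 - a ^+ 3) * x
        - a ^+ 2 * b ^+ 2 * c + b ^+ 3)
      + 3%:R * (x * a ^+ 3 * (c - x) ^+ 3 - b ^+ 3 * (c - x) ^+ 3
         - 9%:R * x ^+ 2 - 6%:R * x * a * b * (c - x) ^+ 2)).
      by rewrite /D /branch_disc b1E a1E; ring.
    have -> : a ^+ 2 * b ^+ 2 = c ^+ 2.
      rewrite bE; transitivity (a ^+ 8 * c ^+ 4 * c ^+ 2); first by ring.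
      by rewrite x8 // c4 !mul1r.
    have -> : b ^+ 3 = a * c by rewrite -cj3.
    by rewrite three0; ring.
  have cN : - c != c by rewrite -subr_eq0 -opprD oppr_eq0 -mulr2n -mulr_natl
    mulf_neq0.
  have ci : i * c != c.
    rewrite -subr_eq0 -[X in _ - X]mul1r -mulrBl mulf_neq0 // subr_eq0.
    by apply: contra_eq_neq i2 => ->; rewrite expr1n -subr_eq0 opprK.
  have aN : a ^+ 3 = - a.
    have := other _ (uN _ uc) cN; rewrite DcE => E.
    have E' : 16%:R - 8%:R * c ^+ 2 * (a ^+ 3 + a) = 1.
      rewrite -[RHS]E.
      transitivity (16%:R * (c ^+ 4 * c ^+ 4) - 8%:R * (c ^+ 4 * c ^+ 2) * (a
        ^+ 3 + a)).
        by rewrite c4; ring.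
      by ring.
    apply: (mulfI (expf_neq0 2 c0)); apply/eqP; rewrite -subr_eq0; apply/eqP.
    transitivity (16%:R - 8%:R * c ^+ 2 * (a ^+ 3 + a) - 1
      + 3%:R * (3%:R * c ^+ 2 * (a ^+ 3 + a) - 5%:R)); first by ring.
    by rewrite E' three0; ring.
  have := other _ (unitaryM ui uc) ci; rewrite DcE aN => E.
  have i3 : (i - 1) ^+ 3 = 2%:R + 2%:R * i.
    by transitivity (i * i ^+ 2 - 3%:R * i ^+ 2 + 3%:R * i - 1); [|rewrite i2];
      ring.
  have E' : 4%:R - 4%:R * (i * a * c ^+ 2) = 1.
    rewrite -[RHS]E; transitivity (i ^+ 2 * (i - 1) ^+ 3 * c ^+ 4
      * (c ^+ 4 * (i - 1) + a * c ^+ 2 * (i + 1))); last by ring.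
    rewrite i2 i3 c4; transitivity (- 2%:R * (i ^+ 2 - 1)
      - 2%:R * a * c ^+ 2 * (i ^+ 2 + 2%:R * i + 1)); last by ring.
    by rewrite i2; ring.
  have : i * a * c ^+ 2 != 0 by rewrite mulf_neq0 ?expf_neq0 // mulf_neq0.
  move/eqP; case; transitivity (4%:R * (i * a * c ^+ 2));
    first by rewrite four1 mul1r.
  transitivity (3%:R + (1 - (4%:R - 4%:R * (i * a * c ^+ 2)))); first by ring.
  by rewrite E' three0 subrr addr0.
have [E1|[D0 _ _]] := circ 1 (unitary1 cj); last exact: no_zero (unitary1 cj) D0.
have [E2|[D0 _ _]] := circ _ (uN _ (unitary1 cj));
  last exact: no_zero (uN _ (unitary1 cj)) D0.
have [E3|[D0 _ _]] := circ _ ui; last exact: no_zero ui D0.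
have [E4|[D0 _ _]] := circ _ (uN _ ui); last exact: no_zero (uN _ ui) D0.
move: E1 E2 E3 E4; rewrite !sqrrN i2 expr1n !DE.
set d0 := a1 ^+ 2 * _; set d1 := _ + b1 ^+ 3; set d2 := _ + _ * b1.
set d3 := _ + b ^+ 3; set d4 := a ^+ 2 * _ => E1 E2 E3 E4.
have i3 : i ^+ 3 = - i by rewrite exprS i2 mulrN1.
have i4 : i ^+ 4 = 1 by rewrite (prim_expr_order iP).
have E3' : - (d0 + d1 * i - d2 - d3 * i + d4) = 1.
  by rewrite -[RHS]E3 i2 i3 i4; ring.
have E4' : - (d0 - d1 * i - d2 + d3 * i + d4) = 1.
  rewrite -[RHS]E4 -[(- i) ^+ 4]/(- i * (- i) ^+ 3) -[(- i) ^+ 3]/(- i * (- i)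
    ^+ 2).
  by rewrite sqrrN i2; transitivity (- d0 + d1 * i + d2 + d3 * - i + d4 * i ^+
    2); [rewrite i2|]; ring.
have E1' : d0 + d1 + d2 + d3 + d4 = 1 by rewrite -[RHS]E1; ring.
have E2' : d0 - d1 + d2 - d3 + d4 = 1 by rewrite -[RHS]E2; ring.
have d30 : d3 = 0.
  apply: (mulfI (mulf_neq0 four0 i0)); rewrite mulr0.
  transitivity (i * ((d0 + d1 + d2 + d3 + d4) - (d0 - d1 + d2 - d3 + d4))
    + (- (d0 + d1 * i - d2 - d3 * i + d4) + (d0 - d1 * i - d2 + d3 * i + d4))).
    by ring.
  by rewrite -[X in _ + (_ + X)]opprK E1' E2' E3' E4'; ring.
have d21 : d2 = 1.
  apply: (mulfI four0).
  transitivity ((d0 + d1 + d2 + d3 + d4) + (d0 - d1 + d2 - d3 + d4)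
    + (- (d0 + d1 * i - d2 - d3 * i + d4) + - (d0 - d1 * i - d2 + d3 * i + d4))).
    by ring.
  by rewrite E1' E2' E3' E4'; ring.
have d40 : d0 + d4 = 0.
  apply: (mulfI four0).
  transitivity ((d0 + d1 + d2 + d3 + d4) + (d0 - d1 + d2 - d3 + d4)
    - (- (d0 + d1 * i - d2 - d3 * i + d4) + - (d0 - d1 * i - d2 + d3 * i + d4))).
    by ring.
  by rewrite E1' E2' E3' E4'; ring.
have [b0|b0] := eqVneq b 0.
  split=> //; apply/eqP/negPn/negP => a0; case/eqP: res0.
  have aN : a ^+ 3 = - a.
    apply/eqP; rewrite -addr_eq0 -oppr_eq0 -d40 /d0 /d4 b0 rmorph0 cj3; apply/eqP.
    by transitivity (- (a ^+ 3 + a ^+ 9)); [rewrite x9 | ring].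
  have aa : a * a1 = 1.
    rewrite cj3 -(x8 _ a0); transitivity (a * a ^+ 3); first by [].
    have a2 : a ^+ 2 = -1 by apply: (mulfI a0); rewrite -exprS aN mulrN1.
    by transitivity ((a ^+ 2) ^+ 2); [ring | transitivity ((a ^+ 2) ^+ 4);
      [rewrite a2|]; ring].
  by rewrite /base_res aa b0 rmorph0; ring.
pose A := a * a1; pose B := b * b1.
have b2 : b ^+ 2 = - a * (A + B).
  apply: (mulfI b0); apply/eqP; rewrite -subr_eq0 -d30 /d3 /A /B; apply/eqP; ring.
have a0 : a != 0.
  by apply: contra_neq b0 => a0; apply/eqP; rewrite -sqrf_eq0 b2 a0 oppr0 mul0r.
have A2 : A ^+ 2 = 1 by rewrite /A cj3 -(x8 _ a0); ring.
have B2 : B ^+ 2 = 1 by rewrite /B cj3 -(x8 _ b0); ring.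
have AB : A * B = -1.
  have E : A ^+ 2 + B ^+ 2 + 4%:R * (A * B) = 1 by rewrite -[RHS]d21 /d2 /A /B;
    ring.
  move: E; rewrite A2 B2 four1 mul1r => E.
  by transitivity (1 + 1 + A * B - 2%:R); [ring | rewrite E; ring].
have A0 : A != 0 by rewrite mulf_neq0 ?fmorph_eq0.
have AB0 : A + B = 0.
  by apply: (mulfI A0); rewrite mulr0 mulrDr -expr2 A2 AB subrr.
by move: b0; rewrite -sqrf_eq0 b2 AB0 mulr0 eqxx.
Qed.

End BranchLocus.

(** * The monomial case and the subfield *)

Lemma circle_injective_monomial (F : finFieldType) (q : nat) (cj : {rmorphism F
  -> F}) :
  #|F| = (q ^ 2)%N -> odd q -> (1 < q)%N -> (forall x, cj x = x ^+ q) ->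
  circle_injective cj 0 0 <-> ~~ (3 %| q.+1)%N.
Proof.
move=> cardF q_odd q_gt1 cjE; split.
  move=> inj; apply/negP => /dvdnP[k kE].
  have [z zP] := unitary_prim_root cardF q_odd q_gt1.
  have uz : unitary cj (z ^+ k).
    by rewrite (unitaryE cjE) -exprM mulnC exprM (prim_expr_order zP) expr1n.
  have : z ^+ k = 1.
    apply: inj => //; first exact: unitary1.
    rewrite /hrec /hquad rmorph0; transitivity (1 : F); first by ring.
    by transitivity (z ^+ (k * 3));
      [rewrite -kE (prim_expr_order zP) | rewrite exprM; ring].
  move/eqP; rewrite -(prim_order_dvd zP) => /dvdn_leq.
  by lia.
move=> q3; apply/circle_injectiveP => y z uy uz.
rewrite /collision rmorph0 => E; have z0 := unitary_neq0 uz.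
have w3 : (y / z) ^+ 3 = 1.
  apply/eqP; rewrite -subr_eq0; apply/eqP.
  transitivity ((y - z) / z ^+ 3 * ((y + z) ^+ 2 + (0 + 0 * (y * z)) * (y + z)
    + 0 * (y * z) ^+ 2 + (0 * 0 - 0 * 0 - 1) * (y * z) + 0)); first by field.
  by rewrite E mulr0.
have : (y / z) ^+ q.+1 = 1.
  by apply/eqP; rewrite -(unitaryE cjE); apply: unitaryM => //; apply: unitaryV.
rewrite (divn_eq q.+1 3) exprD mulnC exprM w3 expr1n mul1r => wr.
suff w1 : y / z = 1 by rewrite -(divfK z0 y) w1 mul1r.
have : ((q.+1 %% 3)%N == 1%N) || ((q.+1 %% 3)%N == 2) by lia.
case/orP => /eqP r; rewrite r in wr; first by [].
by rewrite -w3 exprS wr mulr1.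
Qed.

(** The fixed points of the involution form the image of the subfield. *)
Lemma fixed_subfield (k F : finFieldType) (iota : {rmorphism k -> F}) (x : F) :
  x ^+ #|k| = x -> exists d, x = iota d.
Proof.
move=> xq; have E : ('X^#|k| - 'X : {poly F}) = \prod_(d : k) ('X - (iota d)%:P).
  have := congr1 (map_poly iota) (finField_genPoly k).
  rewrite rmorphB rmorphXn /= map_polyX rmorph_prod /= => ->.
  by apply: eq_bigr => d _; rewrite rmorphB /= map_polyX map_polyC.
have : root ('X^#|k| - 'X) x by rewrite /root !hornerE xq subrr.
rewrite E /root horner_prod => /eqP/eqP; rewrite prodf_seq_eq0 => /hasP[d _].
by rewrite /= hornerXsubC subr_eq0 => /eqP ->; exists d.
Qed.

Theorem theoremA (p n q : nat) (p_prime : prime p) (n_gt0 : (0 < n)%N)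
    (q_def : q = (p ^ n)%N) (q_odd : odd q)
    (Fq Fq2 : finFieldType) (card_Fq : #|Fq| = q) (card_Fq2 : #|Fq2| = (q ^ 2)%N)
    (iota : {rmorphism Fq -> Fq2}) (a b : Fq2) :
  permutation_polynomial (a *: 'X + b *: 'X^q + 'X^(2 * q - 1)) <->
  [\/ [/\ a = 0, b = 0 & (q = 1 %[mod 6]) \/ (q = 3 %[mod 6])],
      ((- a) ^+ ((q + 1) %/ 2) = -1 \/ (- a) ^+ ((q + 1) %/ 2) = iota 3%:R)
        /\ b = 0,
      [/\ a * b != 0, a = b ^ (1 - q%:Z)
        & square_of_units iota (1 - 4%:R * a / b ^+ 2)]
    | [/\ a * b * (a - b ^ (1 - q%:Z)) != 0,
          square_of_units iota (1 - 4%:R * a / b ^+ 2)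
        & b ^+ 2 - a ^+ 2 * b ^+ (q - 1) - 3%:R * a = 0]].
Proof.
have p_gt1 := prime_gt1 p_prime.
have q_gt1 : (1 < q)%N by rewrite q_def -(exp1n n) ltn_exp2r.
have pF : p \in [pchar Fq2].
  by apply: (@card_finPcharP _ _ (n * 2)) => //; rewrite card_Fq2 q_def expnM.
have [cj] := frobenius_morph n pF; rewrite -q_def => cjE.
have qF : q%:R = 0 :> Fq2 by rewrite q_def natrX (pcharf0 pF) expr0n gtn_eqF.
have two0 : 2%:R != 0 :> Fq2.
  apply/eqP => t0; have := qF;
    rewrite -(odd_double_half q) q_odd -muln2 natrD natrM t0.
  by rewrite mulr0 addr0 => /eqP; rewrite oner_eq0.
have cjK := cjK card_Fq2 cjE.
have m2 : (2 * (q.+1 %/ 2))%N = q.+1 by lia.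
have bq : cj b = b * b ^+ (q - 1) by rewrite cjE -exprS subn1 prednK // ltnW.
have bqE : b != 0 -> b ^ (1 - q%:Z) = b / cj b.
  by move=> b0; rewrite expfzDr // expr1z -exprz_inv -exprnP exprVn cjE.
have sqP c : (exists d, [/\ d != 0, cj d = d & c = d ^+ 2]) <-> square_of_units
  iota c.
  split=> [[d [d0 dR ->]]|[d d0 ->]].
    have [e eE] : exists e, d = iota e by apply: fixed_subfield;
      rewrite card_Fq -cjE.
    by exists e; rewrite -?eE // -(fmorph_eq0 iota) -eE.
  exists (iota d); split; rewrite ?fmorph_eq0 //.
  by rewrite cjE -rmorphXn -card_Fq expf_card.
rewrite (permutation_trinomialP card_Fq2 q_odd q_gt1 cjE) addn1 rmorph_nat.
split=> [[h0 inj]|].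
  have [ab0|ab0] := boolP ((a != 0) || (b != 0)); last first.
    move: ab0; rewrite negb_or !negbK => /andP[/eqP a0 /eqP b0].
    apply: Or41; split=> //; move: inj; rewrite a0 b0.
    move/(circle_injective_monomial card_Fq2 q_odd q_gt1 cjE) => q3.
    by lia.
  have [res0|res0] := eqVneq (base_res a b (cj a) (cj b)) 0.
    have [aa bE] := selfrec_of_res0 card_Fq2 cjE h0 res0.
    have a0 : a != 0 by apply: contra_eq_neq aa => ->;
      rewrite mul0r eq_sym oner_eq0.
    have [b0|b0] := eqVneq b 0.
      by apply: Or42; split=> //; left;
        exact: (selfrec_sign card_Fq2 q_odd q_gt1 cjE two0 h0 b0 aa).
    have aE : a = b / cj b by rewrite [X in X / _]bE mulfK // fmorph_eq0.
    apply: Or43; split; rewrite ?mulf_neq0 ?bqE //.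
    by apply/sqP; apply: (selfrec_square card_Fq2 q_odd q_gt1 cjE two0 h0 b0 aE).
  have [q4|q4] := ltnP 4 q; last first.
    have q3 : q = 3 by lia.
    have [a0 b0] := branch_locus_three card_Fq2 q_odd q_gt1 cjE two0 qF h0 inj
      res0 q3.
    by move: ab0; rewrite a0 b0 eqxx.
  have [[three0 b0 aa]|[a0 b0 d4 aR bE]] :=
      branch_locus card_Fq2 q_odd q_gt1 cjE two0 qF h0 inj res0 q4 ab0.
    by apply: Or42; split=> //; right;
      exact: (nine_sign card_Fq2 q_odd q_gt1 cjE two0 h0 inj three0 b0 aa).
  have sq : square_of_units iota (1 - 4%:R * a / b ^+ 2).
    by apply/sqP; exact: (total_branching_square card_Fq2 q_odd q_gt1 cjE two0
      h0 inj a0 b0 d4 aR bE).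
  have [aE|aE] := eqVneq a (b / cj b).
    by apply: Or43; split; rewrite ?mulf_neq0 ?bqE.
  apply: Or44; split; rewrite ?bqE // ?mulf_neq0 ?subr_eq0 //.
  apply: (mulfI b0); rewrite mulr0 -[RHS]bE bq; ring.
case=> [[a0 b0 q6]|[am b0]|[ab0 aE /sqP[d [d0 dR dE]]]|[ab0 /sqP[d [d0 dR dE]]
  bE]].
- split=> [y uy|].
    by rewrite a0 b0 /hquad mul0r !addr0 expf_neq0 // (unitary_neq0 uy).
  rewrite a0 b0; apply/(circle_injective_monomial card_Fq2 q_odd q_gt1 cjE).
  by case: q6; lia.
- case: am => am.
    have h0 y : unitary cj y -> hquad a b y != 0.
      rewrite (unitaryE cjE) => /eqP y1; apply/eqP; rewrite /hquad b0 mul0r addr0.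
      move/eqP; rewrite addr_eq0 => /eqP yE.
      have : (- a) ^+ (q.+1 %/ 2) = 1 by rewrite -[- a]yE -exprM m2.
      by rewrite am => /eqP; rewrite eq_sym -subr_eq0 opprK -mulr2n (negPf two0).
    split=> //; apply: (circle_injective_selfrec) => //;
      last by rewrite b0 rmorph0 mulr0.
    transitivity ((- a) * cj (- a)); first by rewrite rmorphN mulrNN.
    by rewrite cjE -exprS -m2 mulnC exprM am sqrrN expr1n.
  have [three0|three0] := eqVneq (3%:R : Fq2) 0.
    have a0 : a = 0.
      apply/eqP; rewrite -oppr_eq0; move: am => /eqP; rewrite three0 expf_eq0.
      by case/andP.
    split=> [y uy|].
      by rewrite a0 b0 /hquad mul0r !addr0 expf_neq0 // (unitary_neq0 uy).
    rewrite a0 b0; apply/(circle_injective_monomial card_Fq2 q_odd q_gt1 cjE).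
    apply/negP => /dvdnP[k kE];
      have : q.+1%:R = 0 :> Fq2 by rewrite kE natrM three0 mulr0.
    by rewrite -addn1 natrD qF add0r => /eqP; rewrite oner_eq0.
  have inj := circle_injective_nine card_Fq2 q_odd q_gt1 cjE two0 b0 am three0.
  split; last exact/circle_injectiveP.
  by move=> y uy; apply: hquad_neq0_of_injective inj uy.
- move: ab0; rewrite mulf_eq0 negb_or => /andP[a0 b0].
  rewrite bqE // in aE; have b10 : cj b != 0 by rewrite fmorph_eq0.
  have h0 := hquad_neq0_selfrec two0 b0 aE d0 dR dE.
  split=> //; apply: circle_injective_selfrec => //.
    by rewrite aE fmorph_div /= cjK; field; rewrite b0 b10.
  by rewrite aE fmorph_div /= cjK divfK.
- move: ab0; rewrite !mulf_eq0 !negb_or => /andP[/andP[a0 b0] _].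
  have bE' : b ^+ 3 - a ^+ 2 * cj b - 3%:R * a * b = 0.
    transitivity (b * (b ^+ 2 - a ^+ 2 * b ^+ (q - 1) - 3%:R * a));
      last by rewrite bE mulr0.
    by rewrite bq; ring.
  have inj := circle_injective_square card_Fq2 cjE two0 a0 b0 d0 dR dE bE'.
  split; last exact/circle_injectiveP.
  by move=> y uy; apply: hquad_neq0_of_injective inj uy.
Qed.
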